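(* There exists a numerical constant $c>0$ such that the following holds for every $n\ge 1$, every $\sigma>0$ and every $\gamma\le 0.5$. (i) For all integers $0\le k_0\le \sqrt n$ and $1\le \Delta\le n-k_0$, $$\rho_{\gamma}^{*2}[k_0,\Delta]\ \ge\ \sigma^2\,\Delta\,\log\Big[1+\frac{\sqrt n}{8\Delta}\Big].$$ (ii) For all integers $k_0>\sqrt n$ and $1\le\Delta\le n-k_0$, $$\rho_{\gamma}^{*2}[k_0,\Delta]\ \ge\ c\,\sigma^2\begin{cases}\Delta\left[\dfrac{\log^2\big[1+\frac{k_0}{\Delta}\big]}{\log\big[1+\frac{k_0}{\sqrt n}\big]}\wedge \log\big[1+\frac{k_0}{\Delta}\big]\right] & \text{if }\Delta\le k_0\wedge(n-k_0),\\[2ex] \dfrac{k_0}{\log\big[1+\frac{k_0}{\sqrt n}\big]} & \text{if } k_0<\Delta\le n-k_0.\end{cases}$$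
   Context: Model: $Y=(Y_1,\dots,Y_n)$ with $Y_i=\theta_i+\epsilon_i$, where $\theta\in\mathbb R^n$ is unknown and the $\epsilon_i$ are i.i.d. $\mathcal N(0,\sigma^2)$ with known $\sigma>0$; $\mathbb P_\theta$ is the law of $Y$. $\|\theta\|_0$ is the number of non-zero entries of $\theta$. For an integer $k\ge0$, $\mathbb B_0[k]=\{\theta\in\mathbb R^n:\|\theta\|_0\le k\}$, $d_2(\theta,\mathbb B_0[k])=\inf_{u\in\mathbb B_0[k]}\|\theta-u\|_2$ (Euclidean norm), and for $k_1>k_0$, $\rho>0$, $\mathbb B_0[k_1,k_0,\rho]=\{\theta\in\mathbb B_0[k_1]: d_2(\theta,\mathbb B_0[k_0])\ge\rho\}$. A test $T$ is a measurable $\{0,1\}$-valued function of $Y$. Its risk is $$R(T;k_0,\Delta,\rho)=\sup_{\theta\in\mathbb B_0[k_0]}\mathbb P_\theta[T=1]+\sup_{\theta\in\mathbb B_0[k_0+\Delta,k_0,\rho]}\mathbb P_\theta[T=0].$$ For a given level $\gamma$, $\rho_\gamma(T;k_0,\Delta)=\sup\{\rho>0: R(T;k_0,\Delta,\rho)>\gamma\}$, and the minimax separation distance is $\rho^*_\gamma[k_0,\Delta]=\inf_T\rho_\gamma(T;k_0,\Delta)$, the infimum being over all tests; $\rho^{*2}_\gamma$ denotes its square. $a\wedge b=\min(a,b)$. *)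

(* Defs.v *)
From HB Require Import structures.
From mathcomp Require Import all_boot all_order all_algebra.
From mathcomp Require Import all_classical all_reals all_analysis.

Set Implicit Arguments.
Unset Strict Implicit.
Unset Printing Implicit Defensive.

Import Order.TTheory GRing.Theory Num.Theory.

Local Open Scope classical_set_scope.
Local Open Scope ring_scope.

Section IidPower.
Context d (T : measurableType d) (R : realType).

Definition tuple_cons n (x : T * n.-tuple T) : n.+1.-tuple T :=
  [tuple of x.1 :: x.2].

Lemma measurable_tuple_cons n :
  measurable_fun [set: T * n.-tuple T] (@tuple_cons n).
Proof. exact: measurable_cons. Qed.

HB.instance Definition _ n := isMeasurableFun.Build _ _ _ _
  (@tuple_cons n) (@measurable_tuple_cons n).

(* The joint law of n independent draws from P, on the product sigma-algebra
   of n.-tuple T. By [iid_powerE] it is the n-fold product of P. *)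
Fixpoint iid_power (P : probability T R) (n : nat) :
    probability (n.-tuple T) R :=
  match n return probability (n.-tuple T) R with
  | 0 => dirac [tuple]
  | n'.+1 => distribution (P \x iid_power P n')%E (@tuple_cons n')
  end.

Lemma iid_powerE (P : probability T R) n (A : 'I_n -> set T) :
  (forall i, measurable (A i)) ->
  iid_power P n [set y | forall i, A i (tnth y i)] = (\prod_(i < n) P (A i))%E.
Proof.
elim: n A => [|n IH] A mA.
  by rewrite big_ord0 /= diracE mem_set//; case.
rewrite big_ord_recl -(IH (fun i => A (lift ord0 i)))//.
rewrite /= /distribution /pushforward -product_measure1E//.
  congr ((_ \x _)%E _); apply/seteqP; split=> -[x y] /=.
  - move=> h; split; first exact: (h ord0).
    by move=> i; have := h (lift ord0 i); rewrite tnthS.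
  - by move=> [h0 h] i; have [j ->|->//] := unliftP ord0 i; rewrite tnthS.
rewrite (_ : [set y | _] = \bigcap_(i in [set: 'I_n])
    ((fun y : n.-tuple T => tnth y i) @^-1` A (lift ord0 i))).
  apply: fin_bigcap_measurable => // i _; rewrite -[_ @^-1` _]setTI.
  by apply: measurable_tnth => //; exact: mA.
by apply/seteqP; split=> y /= h i; [move=> _|]; exact: h.
Qed.

End IidPower.

Section SparseTesting.
Context (R : realType) (n : nat).
Implicit Types (theta u : n.-tuple R) (T : n.-tuple R -> bool).

Definition l0norm theta : nat := #|[pred i : 'I_n | tnth theta i != 0]|.

Definition l2dist theta u : R :=
  Num.sqrt (\sum_(i < n) (tnth theta i - tnth u i) ^+ 2).

Definition B0 (k : nat) : set (n.-tuple R) :=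
  [set theta | (l0norm theta <= k)%N].

Definition dist2 theta (A : set (n.-tuple R)) : R :=
  inf [set l2dist theta u | u in A].

Definition B0sep (k1 k0 : nat) (rho : R) : set (n.-tuple R) :=
  [set theta | B0 k1 theta /\ rho <= dist2 theta (B0 k0)].

(* R^n with the measurable structure on R over which [normal_prob] is a
   probability (the Borel sets). *)
Local Notation Rn := (n.-tuple (measurableTypeR R)).

(* The law of theta + epsilon; the second parameter of [normal_prob] is the
   standard deviation. *)
Definition gauss_law (sigma : R) theta : set (n.-tuple R) -> \bar R :=
  pushforward (iid_power (normal_prob 0 sigma) n)
    (fun eps : Rn => [tuple tnth theta i + tnth eps i | i < n] : Rn).

Definition is_test T := measurable_fun [set: Rn] (T : Rn -> bool).

Definition risk (sigma : R) T (k0 D : nat) (rho : R) : \bar R :=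
  (ereal_sup [set gauss_law sigma theta [set y | T y = true]
               | theta in B0 k0] +
   ereal_sup [set gauss_law sigma theta [set y | T y = false]
               | theta in B0sep (k0 + D) k0 rho])%E.

(* A supremum in [0, +oo]: adjoining 0 makes the supremum of the empty set
   equal to 0 rather than -oo (whose square would be +oo). *)
Definition sep_dist_test (sigma gamma : R) T (k0 D : nat) : \bar R :=
  ereal_sup (0%E |` [set rho%:E | rho in
    [set rho : R | 0 < rho /\ (gamma%:E < risk sigma T k0 D rho)%E]]).

Definition sep_dist (sigma gamma : R) (k0 D : nat) : \bar R :=
  ereal_inf [set sep_dist_test sigma gamma T k0 D | T in is_test].

End SparseTesting.
Arguments sep_dist {R} n sigma gamma k0 D.

(* Main.v *)
Require Import Defs.
From HB Require Import structures.
From mathcomp Require Import all_boot all_order all_algebra.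
From mathcomp Require Import all_classical all_reals all_analysis.
From mathcomp Require Import measurable_realfun ring lra zify.

Set Implicit Arguments.
Unset Strict Implicit.
Unset Printing Implicit Defensive.

Import Order.TTheory GRing.Theory Num.Theory.
Import numFieldNormedType.Exports.

(** Every bound is obtained by Le Cam's method with finitely supported priors
    on the two hypotheses, whose mixtures are compared through their chi-square
    divergence.

    In case (i), in case (ii) for bounded D, and in case (ii) when
    k0^2 < n^(3/2) and k0 D^2 is at most of order n^(3/2), one prior is a point
    mass and the other one shifts a single uniformly chosen coordinate in each
    of D disjoint blocks: by +a or -a where the vector is 0, or, for bounded D,
    by -a where it equals a (which erases D nonzero entries).

    Otherwise the coordinates are i.i.d. under both priors. The two laws of a
    coordinate agree up to the moment of order 2K + 1 and live on [-M, M] with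
    M^2 of order K sigma^2, so that the divergence between them is exponentially
    small in K; the null one has an atom of mass proportional to eta at 0 that
    is replaced by values of modulus at least a under the alternative. The
    Lagrange weights at 0 of Chebyshev nodes of [a^2, M^2] provide such a pair
    with log(1/eta) of order K a / M. Taking K of order log(1 + k0 / sqrt n) and
    eta of order D / k0 makes a^2 of order
    sigma^2 log^2(1 + k0 / D) / log(1 + k0 / sqrt n). The random number of
    nonzero entries is controlled by Chernoff bounds. When k0^2 >= n^(3/2), the
    first k0 + D entries are all nonzero under the alternative; otherwise each
    of the n entries is nonzero with probability (k0 + 3 D / 4) / n. *)

(** With a point mass on one side, block designs reach only log(1 + sqrt n / D) or log(1 + k0 /
    D^2). Beyond that the extra entries must hide among k0 entries of unknown values, so both
    hypotheses carry mixtures, whose chi-square divergence has no closed form. The two laws of a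
    coordinate therefore share an atom of mass at least 1/4: relative to the Gaussian centred there,
    the null density is at least 1/4, and the divergence is bounded by a quadratic form in the
    difference of the laws with kernel exp(z z'), whose first Taylor terms vanish by the moment
    conditions.

    Increasing K decreases a, so K is kept just large enough for the divergences to be summed over
    all random coordinates. With k0 + D coordinates this asks for K of order log k0, comparable to
    log(1 + k0 / sqrt n) when k0^2 >= n^(3/2). With n coordinates, nonzero with probability about k0
    / n, log(k0^2 / n) is enough, but the sparsity fluctuates by sqrt k0, which D must exceed by a
    large factor.

    The divergence costs 1/4 of the risk and the prior mass off the hypotheses less than 1/4, which
    leaves more than 1/2. *)

Local Open Scope classical_set_scope.
Local Open Scope ring_scope.

(** * Gaussian likelihood ratios *)

Section GaussianShift.
Context (R : realType).
Implicit Types (m s t x : R).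

(** The Radon-Nikodym derivative of the normal law and [normal_pdf] have the same integral over
    every measurable set, hence agree almost everywhere. *)
Lemma ge0_integral_normal m s (f : measurableTypeR R -> \bar R) : s != 0 ->
  measurable_fun setT f -> (forall x, 0 <= f x)%E ->
  (\int[normal_prob m s]_x f x =
   \int[lebesgue_measure]_x (f x * (normal_pdf m s x)%:E))%E.
Proof.
move=> s0 mf f0.
have dom : normal_prob m s `<< (@lebesgue_measure R) by exact: normal_prob_dominates.
rewrite -(Radon_Nikodym_SigmaFinite.change_of_variables dom)//.
apply: ae_eq_integral => //.
- apply: emeasurable_funM => //.
  exact: measurable_int (Radon_Nikodym_SigmaFinite.f_integrable dom).
- apply: emeasurable_funM => //.
  by apply/measurable_EFinP; exact: measurable_normal_pdf.
- apply: ae_eqe_mul2l; apply: integral_ae_eq => //.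
  + exact: Radon_Nikodym_SigmaFinite.f_integrable.
  + by apply/measurable_EFinP; exact: measurable_normal_pdf.
  + by move=> A _ mA; rewrite -Radon_Nikodym_SigmaFinite.f_integral.
Qed.

Lemma measurable_translation t :
  measurable_fun setT ((fun x => t + x) : measurableTypeR R -> measurableTypeR R).
Proof. exact: measurable_funD. Qed.

(** The image measure agrees with Lebesgue measure on half-open intervals, which determine it. *)
Lemma lebesgue_measure_translation t (A : set R) : measurable A ->
  pushforward (@lebesgue_measure R)
    ((fun x => t + x) : measurableTypeR R -> measurableTypeR R) A
  = lebesgue_measure A.
Proof.
move=> mA; apply/esym.
pose nu : {measure set measurableTypeR R -> \bar R} :=
  pushforward (@lebesgue_measure R)
     ((fun x => t + x) : measurableTypeR R -> measurableTypeR R).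
rewrite (@lebesgue_measure_unique _ (nu (measurable_translation t)))// => _ [[a b]] _ <-.
rewrite /nu /= /pushforward /=.
rewrite (_ : _ @^-1` _ = `]a - t, b - t]%classic); last first.
  by apply/seteqP; split=> x /=; rewrite !in_itv/= ltrBlDl lerBrDl.
by rewrite !lebesgue_measure_itv/= !lte_fin ltrD2r -!EFinB opprB addrA subrK.
Qed.

Lemma ge0_integral_translation t (f : measurableTypeR R -> \bar R) :
  measurable_fun setT f -> (forall x, 0 <= f x)%E ->
  (\int[lebesgue_measure]_x f (t + x)%R = \int[lebesgue_measure]_x f x)%E.
Proof.
move=> mf f0; have := @ge0_integral_pushforward _ _ _ _ R _
  (measurable_translation t) lebesgue_measure setT f measurableT mf.
rewrite preimage_setT => <- //.
apply: eq_measure_integral => [|mt A mA _]; first exact: measurable_translation.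
exact: lebesgue_measure_translation.
Qed.

(* The density of N(t, s^2) with respect to N(0, s^2). *)
Definition lratio s t x : R := expR (t * x / s ^+ 2 - t ^+ 2 / (2 * s ^+ 2)).

Lemma lratio_ge0 s t x : 0 <= lratio s t x. Proof. exact: expR_ge0. Qed.

Lemma lratio_gt0 s t x : 0 < lratio s t x. Proof. exact: expR_gt0. Qed.

Lemma lratio0 s x : lratio s 0 x = 1.
Proof. by rewrite /lratio mul0r expr0n/= !mul0r subr0 expR0. Qed.

Lemma measurable_lratio s t :
  measurable_fun setT (lratio s t : measurableTypeR R -> measurableTypeR R).
Proof.
apply: measurableT_comp; first exact: measurable_expR.
apply: measurable_funB => //; apply: measurable_funM => //.
Qed.

(** The factor [expR (t * u / s ^+ 2)] is the kernel of every chi-square computation below. *)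
Lemma lratioM s t u x : s != 0 ->
  lratio s t x * lratio s u x = expR (t * u / s ^+ 2) * lratio s (t + u) x.
Proof. by move=> s0; rewrite /lratio -!expRD; congr expR; field. Qed.

Lemma ge0_integral_normal_shift s t (f : measurableTypeR R -> \bar R) : s != 0 ->
  measurable_fun setT f -> (forall x, 0 <= f x)%E ->
  (\int[normal_prob 0 s]_x f (t + x)%R =
   \int[normal_prob 0 s]_x (f x * (lratio s t x)%:E))%E.
Proof.
move=> s0 mf f0.
rewrite !ge0_integral_normal//; last 3 first.
- apply: emeasurable_funM => //; apply/measurable_EFinP; exact: measurable_lratio.
- by move=> x; rewrite mule_ge0// lee_fin lratio_ge0.
- exact: (measurableT_comp mf (measurable_translation t)).
rewrite -[RHS](@ge0_integral_translation t); last 2 first.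
- apply: emeasurable_funM; last by apply/measurable_EFinP; exact: measurable_normal_pdf.
  apply: emeasurable_funM => //; apply/measurable_EFinP; exact: measurable_lratio.
- by move=> x; rewrite !mule_ge0// lee_fin ?lratio_ge0 ?normal_pdf_ge0.
apply: eq_integral => x _; rewrite -muleA -EFinM; congr (_ * _%:E)%E.
rewrite !normal_pdfE// /normal_fun mulrCA; congr (_ * _).
rewrite /lratio -expRD; congr expR.
by field.
Qed.

Lemma integral_lratio s t : s != 0 ->
  (\int[normal_prob 0 s]_x (lratio s t x)%:E = 1)%E.
Proof.
move=> s0; transitivity (\int[normal_prob 0 s]_x (cst 1%E x * (lratio s t x)%:E))%E.
  by apply: eq_integral => x _; rewrite mul1e.
by rewrite -ge0_integral_normal_shift// integral_cst//= probability_setT mule1.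
Qed.

Lemma integral_lratioM s t u : s != 0 ->
  (\int[normal_prob 0 s]_x (lratio s t x * lratio s u x)%:E =
   (expR (t * u / s ^+ 2))%:E)%E.
Proof.
move=> s0; under eq_integral do rewrite lratioM// EFinM.
rewrite ge0_integralZl_EFin ?expR_ge0//.
- by rewrite integral_lratio// mule1.
- by move=> x _; rewrite lee_fin lratio_ge0.
- by apply/measurable_EFinP; exact: measurable_lratio.
Qed.

End GaussianShift.

(** * Integration against n-fold product laws *)

Section IidPowerIntegral.
Local Open Scope ereal_scope.
Context d (T : measurableType d) (R : realType) (P : probability T R).

Lemma ge0_integral_iid_powerS n (f : n.+1.-tuple T -> \bar R) :
  measurable_fun setT f -> (forall x, 0 <= f x) ->
  \int[iid_power P n.+1]_x f x =
  \int[P]_x \int[iid_power P n]_y f (tuple_cons (x, y)).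
Proof.
move=> mf f0; rewrite /= ge0_integral_distribution//.
rewrite fubini_tonelli1//.
- by apply: measurableT_comp => //; exact: measurable_tuple_cons.
- by move=> x /=.
Qed.

Lemma measurable_prod_tnth n (u : 'I_n -> T -> R) :
  (forall i, measurable_fun setT (u i)) ->
  measurable_fun setT (fun x : n.-tuple T => \prod_(i < n) u i (tnth x i))%R.
Proof.
move=> mu; apply: measurable_prod => i _.
exact: (measurableT_comp (mu i) (measurable_tnth i)).
Qed.

Lemma integral_iid_power_prod n (u : 'I_n -> T -> R) :
  (forall i, measurable_fun setT (u i)) -> (forall i x, (0 <= u i x)%R) ->
  \int[iid_power P n]_x (\prod_(i < n) u i (tnth x i))%:E =
  \prod_(i < n) \int[P]_x (u i x)%:E.
Proof.
elim: n u => [|n IH] u mu u0.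
  under eq_integral do rewrite big_ord0.
  by rewrite integral_cst//= probability_setT mule1 big_ord0.
rewrite ge0_integral_iid_powerS; first last.
- by move=> x; rewrite lee_fin prodr_ge0.
- by apply/measurable_EFinP; exact: measurable_prod_tnth.
rewrite big_ord_recl -IH//.
transitivity (\int[P]_x ((u ord0 x)%:E *
  \int[iid_power P n]_y (\prod_(i < n) u (lift ord0 i) (tnth y i))%:E)).
  apply: eq_integral => x _; rewrite -ge0_integralZl_EFin//.
  - apply: eq_integral => y _; rewrite big_ord_recl EFinM /= (tnth_nth x)/=.
    by congr (_ * _%:E); apply: eq_bigr => i _; rewrite tnthS.
  - by move=> y _; rewrite lee_fin prodr_ge0.
  - by apply/measurable_EFinP; exact: (measurable_prod_tnth (fun i => mu _)).
rewrite ge0_integralZr//.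
- by apply/measurable_EFinP; exact: mu.
- by move=> x _; rewrite lee_fin.
- by apply: integral_ge0 => y _; rewrite lee_fin prodr_ge0.
Qed.

End IidPowerIntegral.

Section GaussianVectorShift.
Context (R : realType) (s : R).
Hypothesis s0 : s != 0.
Local Notation Rn n := (n.-tuple (measurableTypeR R)).
Local Notation gauss := (iid_power (normal_prob 0 s)).

Lemma measurable_tuple_translation n (t : 'I_n -> R) :
  measurable_fun setT
    ((fun x => [tuple t i + tnth x i | i < n]) : Rn n -> Rn n).
Proof.
apply/measurable_fun_tnthP => i.
rewrite (_ : _ \o _ = fun x : Rn n => t i + tnth x i).
  exact: (measurableT_comp (measurable_translation (t i)) (measurable_tnth i)).
by apply/funext => x /=; rewrite tnth_mktuple.
Qed.

Lemma ge0_integral_gauss_shift n (t : 'I_n -> R) (f : Rn n -> \bar R) :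
  measurable_fun setT f -> (forall x, 0 <= f x)%E ->
  (\int[gauss n]_x f [tuple (t i + tnth x i)%R | i < n] =
   \int[gauss n]_x (f x * (\prod_(i < n) lratio s (t i) (tnth x i))%:E))%E.
Proof.
elim: n t f => [|n IH] t f mf f0.
  apply: eq_integral => x _; rewrite big_ord0 mule1; congr f.
  by apply: eq_from_tnth => -[].
have mcons : measurable_fun setT
    (fun z : measurableTypeR R * Rn n => f (tuple_cons z)).
  by apply: measurableT_comp => //; exact: measurable_tuple_cons.
pose t' i := t (lift ord0 i).
have mL : measurable_fun setT
    (fun y : Rn n => (\prod_(i < n) lratio s (t' i) (tnth y i))%:E).
  apply/measurable_EFinP.
  apply: (measurable_prod_tnth (u := fun i => lratio s (t' i))) => i.
  exact: measurable_lratio.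
have L0 (y : Rn n) : (0 <= (\prod_(i < n) lratio s (t' i) (tnth y i))%:E)%E.
  by rewrite lee_fin prodr_ge0// => i _; exact: lratio_ge0.
rewrite ge0_integral_iid_powerS//; last first.
  exact: (measurableT_comp mf (measurable_tuple_translation t)).
rewrite ge0_integral_iid_powerS; first last.
- move=> x; rewrite mule_ge0// lee_fin prodr_ge0// => i _; exact: lratio_ge0.
- apply: emeasurable_funM => //; apply/measurable_EFinP.
  apply: (measurable_prod_tnth (u := fun i => lratio s (t i))) => i.
  exact: measurable_lratio.
(* [G] integrates out all coordinates but the first, with their shift already absorbed; the
   one-dimensional shift then finishes. *)
pose G (z : measurableTypeR R) := (\int[gauss n]_y
  (f (tuple_cons (z, y)) * (\prod_(i < n) lratio s (t' i) (tnth y i))%:E))%E.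
have G0 z : (0 <= G z)%E.
  by apply: integral_ge0 => y _; rewrite mule_ge0.
have mG : measurable_fun setT G.
  apply: (measurable_fun_fubini_tonelli_F (fun z : measurableTypeR R * Rn n =>
    f (tuple_cons z) * (\prod_(i < n) lratio s (t' i) (tnth z.2 i))%:E)%E).
    by apply: emeasurable_funM => //; exact: (measurableT_comp mL).
  by move=> z; rewrite mule_ge0.
transitivity (\int[normal_prob 0 s]_x G (t ord0 + x)%R)%E.
  apply: eq_integral => x _; rewrite /G -IH//; last first.
    exact: (measurableT_comp mcons (measurable_pair1 _)).
  apply: eq_integral => y _; congr f; apply: eq_from_tnth => i.
  rewrite tnth_mktuple; have [j ->|->] := unliftP ord0 i.
    by rewrite !tnthS tnth_mktuple.
  by rewrite !(tnth_nth x).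
rewrite ge0_integral_normal_shift//; apply: eq_integral => x _.
rewrite muleC -ge0_integralZl_EFin ?lratio_ge0//; last 2 first.
- by move=> y _; rewrite mule_ge0.
- apply: emeasurable_funM => //.
  exact: (measurableT_comp mcons (measurable_pair1 _)).
apply: eq_integral => y _; rewrite big_ord_recl EFinM muleCA.
rewrite (tnth_nth x)/=; congr (_ * (_ * _%:E))%E.
by apply: eq_bigr => i _; rewrite tnthS.
Qed.

End GaussianVectorShift.

(** * Le Cam's method *)

Section ChiSquare.
Local Open Scope ereal_scope.
Context d (T : measurableType d) (R : realType) (P : probability T R).

Lemma measurable_inv_pos (f : T -> R) : measurable_fun setT f ->
  (forall x, (0 < f x)%R) -> measurable_fun setT (fun x => (f x)^-1)%R.
Proof.
move=> mf f0; rewrite (_ : (fun _ => _) = fun x => (f x `^ (-1))%R).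
  exact: (measurableT_comp (measurable_powR (-1)) mf).
by apply/funext => x; rewrite powR_inv1// ltW.
Qed.

(* With D = (f1 - f0)^2 / f0, AM-GM gives f1 - f0 <= 2 D + f0 / 8, and D
   integrates to the chi-square divergence. *)
Lemma chi2_event_le (f0 f1 : T -> R) (A : set T) : measurable A ->
  measurable_fun setT f0 -> measurable_fun setT f1 ->
  (forall x, (0 < f0 x)%R) -> (forall x, (0 <= f1 x)%R) ->
  \int[P]_x (f0 x)%:E = 1 -> \int[P]_x (f1 x)%:E = 1 ->
  \int[P]_x (f1 x ^+ 2 / f0 x)%:E <= (17 / 16)%:E ->
  \int[P]_(x in A) (f1 x)%:E <= \int[P]_(x in A) (f0 x)%:E + (1 / 4)%:E.
Proof.
move=> mA mf0 mf1 f0_gt0 f1_ge0 int0 int1 chi2.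
pose D x := ((f1 x - f0 x) ^+ 2 / f0 x)%R.
have mV := measurable_inv_pos mf0 f0_gt0.
have mD : measurable_fun setT D.
  by apply: measurable_funM => //; apply: measurable_funX; exact: measurable_funB.
have mED : measurable_fun setT (EFin \o D) by exact/measurable_EFinP.
have mE0 : measurable_fun setT (EFin \o f0) by exact/measurable_EFinP.
have mE1 : measurable_fun setT (EFin \o f1) by exact/measurable_EFinP.
have f0_ge0 x : (0 <= f0 x)%R by exact: ltW.
have D0 x : (0 <= D x)%R by rewrite divr_ge0 ?sqr_ge0.
have intD : \int[P]_x (D x)%:E <= (1 / 16)%:E.
  (* The expanded square with its negative term moved to the other side: nothing is subtracted
     between integrals not yet known to be finite. *)
  have : \int[P]_x ((D x)%:E + 2%:E * (f1 x)%:E) =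
         \int[P]_x ((f1 x ^+ 2 / f0 x)%:E + (f0 x)%:E).
    apply: eq_integral => x _; rewrite -EFinM -!EFinD; congr _%:E; rewrite /D.
    by field; rewrite gt_eqF.
  rewrite ge0_integralD//; last 3 first.
  - by move=> x _; rewrite lee_fin.
  - by move=> x _; rewrite mule_ge0// lee_fin.
  - exact: measurable_funeM.
  rewrite ge0_integralZl_EFin//; last by move=> x _; rewrite lee_fin.
  rewrite ge0_integralD//; last 3 first.
  - by move=> x _; rewrite lee_fin divr_ge0 ?sqr_ge0.
  - apply/measurable_EFinP; apply: measurable_funM => //; exact: measurable_funX.
  - by move=> x _; rewrite lee_fin.
  rewrite int0 int1 mule1 => e.
  have : \int[P]_x (D x)%:E + 2%:E <= (17 / 16 + 1)%:E.
    by rewrite e EFinD leeD2r.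
  rewrite -leeBrDr// => h; apply: (le_trans h).
  by rewrite -EFinB lee_fin; lra.
apply: (@le_trans _ _ (\int[P]_(x in A)
    ((f0 x)%:E + (2%:E * (D x)%:E + (8^-1)%:E * (f0 x)%:E)))).
  apply: ge0_le_integral => //.
  - by move=> x _; rewrite lee_fin.
  - exact: measurable_funTS.
  - apply: measurable_funTS; apply: emeasurable_funD => //.
    by apply: emeasurable_funD; exact: measurable_funeM.
  move=> x _; rewrite -!EFinM -!EFinD lee_fin -subr_ge0.
  rewrite (_ : _ - _ = (4 * (f1 x - f0 x) - f0 x) ^+ 2 / (8 * f0 x))%R.
    by rewrite divr_ge0 ?sqr_ge0// mulr_ge0.
  by rewrite /D; field; rewrite gt_eqF.
rewrite ge0_integralD//; last 4 first.
- by move=> x _; rewrite lee_fin.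
- exact: measurable_funTS.
- by move=> x _; rewrite adde_ge0// mule_ge0// lee_fin.
- by apply: measurable_funTS; apply: emeasurable_funD; exact: measurable_funeM.
rewrite leeD2l// ge0_integralD//; last 4 first.
- by move=> x _; rewrite mule_ge0// lee_fin.
- by apply: measurable_funTS; exact: measurable_funeM.
- by move=> x _; rewrite mule_ge0// lee_fin.
- by apply: measurable_funTS; exact: measurable_funeM.
apply: (@le_trans _ _ (\int[P]_x (2%:E * (D x)%:E) +
                       \int[P]_x ((8^-1)%:E * (f0 x)%:E))).
  apply: leeD; apply: ge0_subset_integral => //.
  - exact: measurable_funeM.
  - by move=> x _; rewrite mule_ge0// lee_fin.
  - exact: measurable_funeM.
  - by move=> x _; rewrite mule_ge0// lee_fin.
rewrite !ge0_integralZl_EFin//; last 2 first.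
- by move=> x _; rewrite lee_fin.
- by move=> x _; rewrite lee_fin.
(* 2 * (1/16) + 1/8 = 1/4 uses up the constant exactly. *)
rewrite int0 mule1; apply: (@le_trans _ _ (2%:E * (1 / 16)%:E + (8^-1)%:E)).
  by rewrite leeD2r// lee_wpmul2l// lee_fin.
by rewrite -EFinM -EFinD lee_fin; lra.
Qed.

End ChiSquare.

(** * Mixtures, and the reduction to a pair of priors *)

Section Mixtures.
Context (R : realType) (s : R) (n : nat).
Hypothesis s_gt0 : 0 < s.
Local Notation Rn := (n.-tuple (measurableTypeR R)).
Local Notation gauss := (iid_power (normal_prob 0 s) n).
Implicit Types (theta base x : n.-tuple R) (A : set (n.-tuple R)).

Let s_neq0 : s != 0. Proof. by rewrite gt_eqF. Qed.

(** Density of N(theta, s^2 I) with respect to N(base, s^2 I), as a function of the noise y -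
    base. *)
Definition vlratio base theta x : R :=
  \prod_(i < n) lratio s (tnth theta i - tnth base i) (tnth x i).

Definition from_base base A : set (n.-tuple R) :=
  [set x | A [tuple tnth base i + tnth x i | i < n]].

Lemma vlratio_ge0 base theta x : 0 <= vlratio base theta x.
Proof. by apply: prodr_ge0 => i _; exact: lratio_ge0. Qed.

Lemma vlratio_gt0 base theta x : 0 < vlratio base theta x.
Proof. by apply: prodr_gt0 => i _; exact: lratio_gt0. Qed.

Lemma measurable_vlratio base theta :
  measurable_fun setT (vlratio base theta : Rn -> measurableTypeR R).
Proof.
apply: (measurable_prod_tnth
  (u := fun i => lratio s (tnth theta i - tnth base i))) => i.
exact: measurable_lratio.
Qed.

Lemma measurable_from_base base A : measurable (A : set Rn) ->
  measurable (from_base base A : set Rn).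
Proof.
move=> mA; rewrite -[from_base _ _]setTI.
exact: (measurable_tuple_translation (tnth base) measurableT mA).
Qed.

(** Shifting the noise by theta - base turns base + x into theta + x; the shift is then traded for a
    density. *)
Lemma gauss_lawE base theta A : measurable (A : set Rn) ->
  gauss_law s theta A =
  (\int[gauss]_(x in from_base base A) (vlratio base theta x)%:E)%E.
Proof.
move=> mA.
have mB : measurable (from_base base A : set Rn) by exact: measurable_from_base.
rewrite integral_mkcond.
transitivity (\int[gauss]_x ((\1_(from_base base A) x)%:E *
   (\prod_(i < n) lratio s (tnth theta i - tnth base i) (tnth x i))%:E))%E; last first.
  apply: eq_integral => x _; rewrite patchE indicE /vlratio.
  by case: (x \in _); rewrite ?mul1e ?mul0e.
rewrite -(@ge0_integral_gauss_shift _ _ s_neq0 _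
  (fun i => tnth theta i - tnth base i) (EFin \o \1_(from_base base A)))//; last first.
- by move=> x /=; rewrite lee_fin.
- by apply/measurable_EFinP; exact: measurable_indic.
pose sh : Rn -> Rn :=
  fun x => [tuple (tnth theta i - tnth base i) + tnth x i | i < n].
have msh : measurable_fun setT sh.
  exact: (measurable_tuple_translation (fun i => tnth theta i - tnth base i)).
rewrite (eq_integral (EFin \o \1_(sh @^-1` from_base base A)))//.
rewrite integral_indic//; last by rewrite -[_ @^-1` _]setTI; exact: msh.
rewrite setIT /gauss_law /pushforward; congr (gauss _).
have shE x : [tuple tnth theta i + tnth x i | i < n] =
    [tuple tnth base i + tnth (sh x) i | i < n].
  by apply: eq_from_tnth => i; rewrite !tnth_mktuple; ring.
by apply/seteqP; split=> x /=; rewrite /from_base/= shE.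
Qed.

Lemma gauss_law_fin theta A : measurable (A : set Rn) ->
  gauss_law s theta A \is a fin_num.
Proof.
move=> mA; apply: fin_num_measure; exact: (measurable_from_base theta).
Qed.

Lemma gauss_lawC theta A : measurable (A : set Rn) ->
  gauss_law s theta (~` A) = (1 - gauss_law s theta A)%E.
Proof.
move=> mA; rewrite /gauss_law /pushforward preimage_setC.
by rewrite probability_setC//; exact: (measurable_from_base theta).
Qed.

Definition mixture (Omega : finType) (p : Omega -> R)
    (theta : Omega -> n.-tuple R) base x : R :=
  \sum_w p w * vlratio base (theta w) x.

Definition mixture_prob (Omega : finType) (p : Omega -> R)
    (theta : Omega -> n.-tuple R) A : R :=
  \sum_w p w * fine (gauss_law s (theta w) A).

Section Mixture.
Context (Omega : finType) (p : Omega -> R) (theta : Omega -> n.-tuple R).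
Hypotheses (p_ge0 : forall w, 0 <= p w) (p_sum1 : \sum_w p w = 1).

Lemma mixture_gt0 base x : 0 < mixture p theta base x.
Proof.
have [w pw] : exists w, 0 < p w.
  apply: contrapT => /forallNP p0.
  suff : \sum_w p w <= 0 by rewrite p_sum1 leNgt ltr01.
  by apply: sumr_le0 => w _; rewrite leNgt; apply/negP; exact: p0.
rewrite /mixture (bigD1 w)//= ltr_wpDr//.
  by apply: sumr_ge0 => v _; rewrite mulr_ge0// vlratio_ge0.
by rewrite mulr_gt0// vlratio_gt0.
Qed.

Lemma measurable_mixture base :
  measurable_fun setT (mixture p theta base : Rn -> measurableTypeR R).
Proof.
apply: measurable_sum => w; apply: measurable_funM => //.
exact: measurable_vlratio.
Qed.

Lemma integral_mixture base A : measurable (A : set Rn) ->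
  (\int[gauss]_(x in from_base base A) (mixture p theta base x)%:E =
   (mixture_prob p theta A)%:E)%E.
Proof.
move=> mA; rewrite /mixture /mixture_prob.
under eq_integral do rewrite -sumEFin.
rewrite ge0_integral_sum//; first last.
- by move=> w x _; rewrite lee_fin mulr_ge0// vlratio_ge0.
- move=> w; apply/measurable_EFinP; apply: measurable_funTS.
  by apply: measurable_funM => //; exact: measurable_vlratio.
- exact: measurable_from_base.
rewrite -sumEFin; apply: eq_bigr => w _; under eq_integral do rewrite EFinM.
rewrite ge0_integralZl_EFin//; first last.
- apply/measurable_EFinP; apply: measurable_funTS; exact: measurable_vlratio.
- by move=> x _; rewrite lee_fin vlratio_ge0.
- exact: measurable_from_base.
by rewrite -gauss_lawE// EFinM fineK// gauss_law_fin.
Qed.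

Lemma mixture_probC A : measurable (A : set Rn) ->
  mixture_prob p theta (~` A) = 1 - mixture_prob p theta A.
Proof.
move=> mA; rewrite /mixture_prob -p_sum1 -sumrB; apply: eq_bigr => w _.
by rewrite gauss_lawC// fineB ?gauss_law_fin//= mulrBr mulr1.
Qed.

Lemma integral_mixtureT base : (\int[gauss]_x (mixture p theta base x)%:E = 1)%E.
Proof.
have -> : setT = from_base base setT by apply/seteqP.
rewrite integral_mixture// -setC0 mixture_probC// /mixture_prob big1 ?subr0// => w _.
by rewrite /gauss_law /pushforward preimage_set0 measure0 mulr0.
Qed.

End Mixture.

(** The integral is 1 plus the chi-square divergence, which is thus at most 1/16. *)
Definition chi2_close (Om0 Om1 : finType) (p0 : Om0 -> R) (p1 : Om1 -> R)
    (th0 : Om0 -> n.-tuple R) (th1 : Om1 -> n.-tuple R) base : Prop :=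
  (\int[gauss]_x (mixture p1 th1 base x ^+ 2 / mixture p0 th0 base x)%:E
    <= (17 / 16)%:E)%E.

Lemma chi2_close_prob (Om0 Om1 : finType) (p0 : Om0 -> R) (p1 : Om1 -> R)
    (th0 : Om0 -> n.-tuple R) (th1 : Om1 -> n.-tuple R) base A :
  (forall w, 0 <= p0 w) -> \sum_w p0 w = 1 ->
  (forall w, 0 <= p1 w) -> \sum_w p1 w = 1 ->
  chi2_close p0 p1 th0 th1 base -> measurable (A : set Rn) ->
  mixture_prob p1 th1 A <= mixture_prob p0 th0 A + 1 / 4.
Proof.
move=> p0_ge0 p0_sum p1_ge0 p1_sum chi2 mA.
rewrite -lee_fin EFinD -!(integral_mixture _ _ base)//.
apply: chi2_event_le => //.
- exact: measurable_from_base.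
- exact: measurable_mixture.
- exact: measurable_mixture.
- by move=> x; exact: mixture_gt0.
- by move=> x; apply/ltW; exact: mixture_gt0.
- exact: integral_mixtureT.
- exact: integral_mixtureT.
Qed.

(** At good parameters the probability is at most the supremum [r]; the others contribute at most
    their prior mass. *)
Lemma ereal_sup_mixture (Om : finType) (p : Om -> R) (th : Om -> n.-tuple R)
    (good : pred Om) (S : set (n.-tuple R)) A (r : R) :
  (forall w, 0 <= p w) -> \sum_w p w = 1 -> measurable (A : set Rn) ->
  (forall w, good w -> S (th w)) -> 0 <= r ->
  ereal_sup [set gauss_law s theta A | theta in S] = r%:E ->
  mixture_prob p th A <= r + \sum_(w | ~~ good w) p w.
Proof.
move=> p_ge0 p_sum mA gS r0 supE.
rewrite /mixture_prob (bigID good)/=; apply: lerD.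
  apply: (@le_trans _ _ (\sum_(w | good w) p w * r)).
    apply: ler_sum => w gw; rewrite ler_wpM2l// -lee_fin fineK ?gauss_law_fin//.
    by rewrite -supE; apply: ereal_sup_ubound; exists (th w) => //; exact: gS.
  rewrite -mulr_suml -[leRHS]mul1r ler_wpM2r// -p_sum [leRHS](bigID good)/=.
  by rewrite lerDl sumr_ge0.
apply: ler_sum => w _; rewrite -[leRHS]mulr1 ler_wpM2l// -lee_fin fineK ?gauss_law_fin//.
by apply: probability_le1; exact: (measurable_from_base (th w)).
Qed.

(** The inequality is strict so that the level 1/2 itself satisfies the strict inequality in
    [sep_dist_test]. *)
Definition hard (k0 D : nat) (rho : R) : Prop :=
  0 < rho /\ forall T : n.-tuple R -> bool, is_test T ->
    ((2^-1)%:E < risk s T k0 D rho)%E.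

(** The two errors add up to at least 3/4 minus the bad prior mass, hence to more than 1/2. The
    predicates [good0] and [good1] leave room for a random number of nonzero entries. Either
    direction of the divergence works, since the event inequality may be applied to the
    complement. *)
Lemma hard_of_priors (Om0 Om1 : finType) (p0 : Om0 -> R) (p1 : Om1 -> R)
    (th0 : Om0 -> n.-tuple R) (th1 : Om1 -> n.-tuple R) base
    (good0 : pred Om0) (good1 : pred Om1) (k0 D : nat) (rho : R) :
  0 < rho ->
  (forall w, 0 <= p0 w) -> \sum_w p0 w = 1 ->
  (forall w, 0 <= p1 w) -> \sum_w p1 w = 1 ->
  chi2_close p0 p1 th0 th1 base \/ chi2_close p1 p0 th1 th0 base ->
  (forall w, good0 w -> B0 k0 (th0 w)) ->
  (forall w, good1 w -> B0sep (k0 + D) k0 rho (th1 w)) ->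
  \sum_(w | ~~ good0 w) p0 w + \sum_(w | ~~ good1 w) p1 w < 1 / 4 ->
  hard k0 D rho.
Proof.
move=> rho0 p0_ge0 p0_sum p1_ge0 p1_sum chi2 g0 g1 bad; split=> // T Ttest.
pose A := [set y | T y = true] : set Rn.
have mA : measurable A.
  by rewrite -[A]setTI; exact: (Ttest measurableT [set true]).
have AC : [set y | T y = false] = ~` A.
  by apply/seteqP; split=> y /=; rewrite /A/=; case: (T y).
have exgood (Om : finType) (p : Om -> R) (good : pred Om) :
    \sum_w p w = 1 -> \sum_(w | ~~ good w) p w < 1 -> exists w, good w.
  move=> p_sum; apply: contraPP => /forallNP ng; apply/negP; rewrite -leNgt.
  rewrite -p_sum le_eqVlt; apply/orP; left; apply/eqP; apply: eq_bigl => w.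
  by apply/esym/negP; exact: ng.
have bad0_ge0 : 0 <= \sum_(w | ~~ good0 w) p0 w by exact: sumr_ge0.
have bad1_ge0 : 0 <= \sum_(w | ~~ good1 w) p1 w by exact: sumr_ge0.
(* These points keep both suprema above -oo, the supremum of an empty set. *)
have [w0 gw0] : exists w, good0 w by apply: (exgood _ p0) => //; lra.
have [w1 gw1] : exists w, good1 w by apply: (exgood _ p1) => //; lra.
rewrite /risk AC.
set S0 := ereal_sup _; set S1 := ereal_sup _.
have S0_ge0 : (0 <= S0)%E.
  apply: le_ereal_sup_tmp; exists (gauss_law s (th0 w0) A).
    by exists (th0 w0) => //; exact: g0.
  by rewrite /gauss_law /pushforward measure_ge0.
have S1_ge0 : (0 <= S1)%E.
  apply: le_ereal_sup_tmp; exists (gauss_law s (th1 w1) (~` A)).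
    by exists (th1 w1) => //; exact: g1.
  by rewrite /gauss_law /pushforward measure_ge0.
case S0E : S0 S0_ge0 => [r0| |]// r0_ge0; last first.
  by case: S1 S1_ge0 => //= *; rewrite ltry.
case S1E : S1 S1_ge0 => [r1| |]// r1_ge0; last by rewrite ltry.
have e0 := ereal_sup_mixture p0_ge0 p0_sum mA g0 r0_ge0 S0E.
have e1 := ereal_sup_mixture p1_ge0 p1_sum (measurableC mA) g1 r1_ge0 S1E.
rewrite mixture_probC// in e1.
rewrite -EFinD lte_fin.
have e2 : mixture_prob p1 th1 A <= mixture_prob p0 th0 A + 1 / 4.
  case: chi2 => chi2; first exact: chi2_close_prob chi2 mA.
  have := chi2_close_prob p1_ge0 p1_sum p0_ge0 p0_sum chi2 (measurableC mA).
  by rewrite !mixture_probC//; lra.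
lra.
Qed.

(** A larger D only adds alternatives; this reduces k0 < D to D = k0. *)
Lemma hard_leD (k0 D D' : nat) rho : (D <= D')%N -> hard k0 D rho -> hard k0 D' rho.
Proof.
move=> DD' [rho0 h]; split=> // T /h; move/lt_le_trans; apply.
rewrite /risk leeD2l//; apply: ereal_sup_le => _ [th [thB thd] <-].
exists th => //; split=> //; apply: leq_trans thB _; by rewrite leq_add2l.
Qed.

Lemma sep_dist_ge (gamma : R) (k0 D : nat) rho : gamma <= 2^-1 -> hard k0 D rho ->
  ((rho ^+ 2)%:E <= sep_dist n s gamma k0 D ^+ 2)%E.
Proof.
move=> g2 [rho0 h].
have : (rho%:E <= sep_dist n s gamma k0 D)%E.
  apply: le_ereal_inf_tmp => _ [T Ttest <-]; apply: ereal_sup_ubound; right.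
  exists rho => //; split=> //; apply: le_lt_trans (h _ Ttest).
  by rewrite lee_fin.
by move=> le_rho; rewrite EFin_expe !expe2 lee_pmul// lee_fin ltW.
Qed.

End Mixtures.

(** * Block designs *)

Section SparseDistance.
Context (R : realType) (n : nat).
Implicit Types (theta u : n.-tuple R).

(** At least j coordinates of the support of [theta] lie outside the support of a k0-sparse [u], and
    each costs a^2. *)
Lemma dist2_B0_ge theta (k0 j : nat) (a : R) : 0 <= a ->
  (k0 + j <= l0norm theta)%N ->
  (forall i, tnth theta i != 0 -> a <= `|tnth theta i|) ->
  a * Num.sqrt j%:R <= dist2 theta (B0 k0).
Proof.
move=> a0 kj ha; apply: lb_le_inf.
  exists (l2dist theta [tuple 0 | i < n]), [tuple 0 | i < n] => //.
  rewrite /B0/= /l0norm (eq_card0 (A := [pred i | _])) => // i.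
  by rewrite !inE tnth_mktuple eqxx.
move=> _ [u uk <-]; rewrite -{1}(ger0_norm a0) -sqrtr_sqr -sqrtrM ?sqr_ge0//.
rewrite ler_wsqrtr//.
rewrite (bigID (fun i => (tnth theta i != 0) && (tnth u i == 0)))/=.
apply: ler_wpDr; first by apply: sumr_ge0 => i _; exact: sqr_ge0.
apply: (@le_trans _ _
   (\sum_(i < n | (tnth theta i != 0) && (tnth u i == 0)) a ^+ 2)); last first.
  apply: ler_sum => i /andP[ti /eqP ->]; rewrite subr0 -[leRHS]real_normK ?num_real//.
  by rewrite lerXn2r ?nnegrE ?ha.
rewrite sumr_const mulr_natr ler_wpMn2l ?sqr_ge0//.
rewrite -(leq_add2l k0) (leq_trans kj)//.
rewrite /l0norm -[leqLHS](cardID [pred i | tnth u i != 0]).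
apply: leq_add.
  apply: leq_trans uk; rewrite /l0norm; apply: subset_leq_card.
  apply/fintype.subsetP => i.
  by rewrite !inE => /andP[].
by apply: subset_leq_card; apply/fintype.subsetP => i; rewrite !inE negbK andbC.
Qed.

Lemma B0sep_mem theta (k0 D j : nat) (a : R) : 0 <= a ->
  (l0norm theta <= k0 + D)%N -> (k0 + j <= l0norm theta)%N ->
  (forall i, tnth theta i != 0 -> a <= `|tnth theta i|) ->
  B0sep (k0 + D) k0 (a * Num.sqrt j%:R) theta.
Proof. by move=> a0 h1 h2 h3; split=> //; exact: dist2_B0_ge. Qed.

End SparseDistance.

Section MixtureMoments.
Context (R : realType) (s : R) (n : nat).
Hypothesis s_gt0 : 0 < s.
Local Notation gauss := (iid_power (normal_prob 0 s) n).

Lemma integral_vlratioM (base th th' : n.-tuple R) :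
  (\int[gauss]_x (vlratio s base th x * vlratio s base th' x)%:E =
  (\prod_(i < n) expR ((tnth th i - tnth base i) * (tnth th' i - tnth base i)
     / s ^+ 2))%:E)%E.
Proof.
pose u i x := lratio s (tnth th i - tnth base i) x *
              lratio s (tnth th' i - tnth base i) x.
transitivity (\int[gauss]_x (\prod_(i < n) u i (tnth x i))%:E)%E.
  by apply: eq_integral => x _; rewrite /vlratio -big_split.
rewrite integral_iid_power_prod//; last 2 first.
- by move=> i; apply: measurable_funM; exact: measurable_lratio.
- by move=> i x; rewrite mulr_ge0// lratio_ge0.
rewrite -prodEFin; apply: eq_bigr => i _.
by rewrite integral_lratioM// gt_eqF.
Qed.

Lemma integral_mixture_sqr (Om : finType) (p : Om -> R)
    (th : Om -> n.-tuple R) (base : n.-tuple R) : (forall w, 0 <= p w) ->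
  (\int[gauss]_x (mixture s p th base x ^+ 2)%:E =
  (\sum_w \sum_w' p w * p w' *
     \prod_(i < n) expR ((tnth (th w) i - tnth base i) *
        (tnth (th w') i - tnth base i) / s ^+ 2))%:E)%E.
Proof.
move=> p0.
transitivity (\int[gauss]_x (\sum_(ww : Om * Om) (p ww.1 * p ww.2)%:E *
   (vlratio s base (th ww.1) x * vlratio s base (th ww.2) x)%:E))%E.
  apply: eq_integral => x _.
  under [RHS]eq_bigr do rewrite -EFinM.
  rewrite sumEFin; congr _%:E; rewrite expr2 /mixture big_distrlr/= pair_big/=.
  by apply: eq_bigr => -[w w'] _ /=; ring.
rewrite ge0_integral_sum//; last 2 first.
- move=> ww; apply: measurable_funeM; apply/measurable_EFinP.
  by apply: measurable_funM; exact: measurable_vlratio.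
- move=> ww x _; rewrite mule_ge0// lee_fin mulr_ge0// ?vlratio_ge0//.
rewrite pair_big/= -sumEFin; apply: eq_bigr => ww _.
rewrite ge0_integralZl_EFin ?mulr_ge0//.
- by rewrite integral_vlratioM.
- by move=> x _; rewrite lee_fin mulr_ge0// vlratio_ge0.
- by apply/measurable_EFinP; apply: measurable_funM; exact: measurable_vlratio.
Qed.

Lemma vlratio_base (base x : n.-tuple R) : vlratio s base base x = 1.
Proof. by rewrite /vlratio big1// => i _; rewrite subrr lratio0. Qed.

End MixtureMoments.

Section BlockDesign.
Context (R : realType) (s : R) (n D B off : nat) (S : finType) (v : S -> R).
Hypothesis offDB : (off + D * B <= n)%N.
Variable base : n.-tuple R.

Lemma block_pos_subproof (j : 'I_D) (r : 'I_B) : (off + (j * B + r) < n)%N.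
Proof.
apply: leq_trans offDB; rewrite ltn_add2l.
apply: (@leq_trans (j.+1 * B)); first by rewrite mulSn addnC ltn_add2r.
by rewrite leq_mul2r ltn_ord orbT.
Qed.

Definition block_pos (j : 'I_D) (r : 'I_B) : 'I_n :=
  Ordinal (block_pos_subproof j r).

Lemma block_pos_eq (j j' : 'I_D) (r r' : 'I_B) :
  (block_pos j r == block_pos j' r') = (j == j') && (r == r').
Proof.
apply/eqP/andP => [/(congr1 val)/= /addnI e|[/eqP -> /eqP ->]//].
have B_gt0 : (0 < B)%N by exact: leq_ltn_trans (ltn_ord r).
split; apply/eqP/val_inj.
  have := congr1 (divn^~ B) e.
  by rewrite /= !divnMDl// !divn_small// !addn0.
have := congr1 (modn^~ B) e.
by rewrite /= !modnMDl !modn_small.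
Qed.

Implicit Types w : {ffun 'I_D -> 'I_B * S}.

Definition block_shift w (i : 'I_n) : R :=
  \sum_(j < D) (block_pos j (w j).1 == i)%:R * v (w j).2.

Definition block_point w : n.-tuple R :=
  [tuple tnth base i + block_shift w i | i < n].

Lemma block_shift_pos w j : block_shift w (block_pos j (w j).1) = v (w j).2.
Proof.
rewrite /block_shift (bigD1 j)//= eqxx mul1r big1 ?addr0// => j' /negPf j'j.
by rewrite block_pos_eq j'j mul0r.
Qed.

Lemma block_shift_out w i : (forall j, block_pos j (w j).1 != i) ->
  block_shift w i = 0.
Proof. by move=> h; rewrite /block_shift big1// => j _; rewrite (negPf (h j)) mul0r. Qed.

(** Positions in distinct blocks differ, so two draws meet only where they choose the same position
    of the same block. *)
Lemma block_shift_dot w w' :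
  \sum_(i < n) block_shift w i * block_shift w' i =
  \sum_(j < D) ((w j).1 == (w' j).1)%:R * (v (w j).2 * v (w' j).2).
Proof.
rewrite /block_shift.
under eq_bigr do rewrite mulr_suml.
rewrite exchange_big/=; apply: eq_bigr => j _.
under eq_bigr do rewrite mulrAC -mulrA.
rewrite (bigD1 (block_pos j (w j).1))//= eqxx mul1r.
rewrite [X in _ + X]big1 ?addr0; last first.
  by move=> i /negPf ij; rewrite eq_sym ij mul0r.
rewrite mulr_suml (bigD1 j)//= big1 ?addr0.
  by rewrite block_pos_eq eqxx/= eq_sym; ring.
move=> j' /negPf j'j.
by rewrite block_pos_eq j'j !mul0r.
Qed.

Hypotheses (s_gt0 : 0 < s) (B_gt0 : (0 < B)%N) (S_gt0 : (0 < #|S|)%N).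

(** Two draws meet in a block with probability 1 / B, and [delta] bounds the mean excess of the
    exponential over 1 when they do. Blocks being independent, the second moment is at most (1 +
    delta / B)^D <= exp(1/32). *)
Lemma block_chi2 (delta : R) :
  \sum_a \sum_b (expR (v a * v b / s ^+ 2) - 1) <= #|S|%:R ^+ 2 * delta ->
  D%:R * (delta / B%:R) <= 1 / 32 ->
  chi2_close s (fun _ : unit => 1)
    (fun _ : {ffun 'I_D -> 'I_B * S} => (#|{ffun 'I_D -> 'I_B * S}|%:R)^-1)
    (fun=> base) block_point base.
Proof.
move=> hv hD; rewrite /chi2_close.
under eq_integral => x _.
  rewrite [X in _ / X]/mixture big_const card_unit /= addr0 mul1r vlratio_base divr1.
  over.
rewrite integral_mixture_sqr//.
rewrite lee_fin.
pose F (a b : 'I_B * S) : R :=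
  expR ((a.1 == b.1)%:R * (v a.2 * v b.2) / s ^+ 2).
have prodE w w' : \prod_(i < n) expR ((tnth (block_point w) i - tnth base i) *
    (tnth (block_point w') i - tnth base i) / s ^+ 2) = \prod_(j < D) F (w j) (w' j).
  rewrite -!expR_sum; congr expR; rewrite -!mulr_suml; congr (_ / _).
  rewrite -block_shift_dot; apply: eq_bigr => i _.
  by rewrite !tnth_mktuple ![tnth base i + _]addrC !addrK.
pose c : R := #|{ffun 'I_D -> 'I_B * S}|%:R.
rewrite (_ : \sum_w _ = (c ^- 2) * (\sum_a \sum_b F a b) ^+ D); last first.
  rewrite -[in RHS](card_ord D) -prodr_const bigA_distr_bigA/= mulr_sumr.
  apply: eq_bigr => w _.
  rewrite bigA_distr_bigA/= mulr_sumr; apply: eq_bigr => w' _.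
  by rewrite prodE -invfM expr2.
have cE : c = (B%:R * #|S|%:R) ^+ D.
  by rewrite /c card_ffun card_prod !card_ord natrX natrM.
have B0 : (0 : R) < B%:R by rewrite ltr0n.
have S0 : (0 : R) < #|S|%:R by rewrite ltr0n.
have sumF : \sum_a \sum_b F a b <= (B%:R * #|S|%:R) ^+ 2 * (1 + delta / B%:R).
  have -> : \sum_a \sum_b F a b = (B%:R * #|S|%:R) ^+ 2 +
      B%:R * \sum_a \sum_b (expR (v a * v b / s ^+ 2) - 1).
    rewrite -(pair_bigA _ (fun r a => \sum_b F (r, a) b))/=.
    rewrite (eq_bigr (fun=> (B%:R * #|S|%:R ^+ 2 +
      \sum_a \sum_b (expR (v a * v b / s ^+ 2) - 1)))) => [|r _].
      by rewrite sumr_const card_ord -[LHS]mulr_natr; ring.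
    rewrite (eq_bigr (fun a => B%:R * #|S|%:R +
        \sum_b (expR (v a * v b / s ^+ 2) - 1))) => [|a _].
      by rewrite big_split/= sumr_const -[_ *+ #|_|]mulr_natr; ring.
    rewrite -(pair_bigA _ (fun r' b => F (r, a) (r', b)))/=.
    rewrite (eq_bigr (fun r' => #|S|%:R + (r' == r)%:R *
        \sum_b (expR (v a * v b / s ^+ 2) - 1))) => [|r' _].
      rewrite big_split/= sumr_const card_ord -[_ *+ B]mulr_natl; congr (_ + _).
      rewrite (bigD1 r)//= eqxx mul1r [X in _ + X]big1 ?addr0// => r' /negPf ->.
      by rewrite mul0r.
    rewrite mulr_sumr -[#|S|%:R](@sumr_const _ _ S) -big_split/=.
    apply: eq_bigr => b _; rewrite /F/= eq_sym; case: (r' == r).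
      by rewrite !mul1r addrC subrK.
    by rewrite !mul0r expR0 addr0.
  rewrite mulrDr mulr1 lerD2l (_ : _ * (delta / _) = B%:R * (#|S|%:R ^+ 2 * delta)).
    by rewrite ler_pM2l.
  by field; rewrite gt_eqF.
have F0 : 0 <= \sum_a \sum_b F a b.
  by apply: sumr_ge0 => a _; apply: sumr_ge0 => b _; exact: expR_ge0.
have d0 : 0 <= 1 + delta / B%:R.
  have : 0 <= (B%:R * #|S|%:R) ^+ 2 * (1 + delta / B%:R) by exact: le_trans sumF.
  by rewrite pmulr_rge0// exprn_gt0// mulr_gt0.
apply: (@le_trans _ _ ((1 + delta / B%:R) ^+ D)).
  rewrite cE -exprM mulnC exprM -exprVn -exprMn lerXn2r ?nnegrE//.
    by rewrite mulr_ge0// invr_ge0 exprn_ge0// mulr_ge0// ltW.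
  by rewrite mulrC ler_pdivrMr ?exprn_gt0 ?mulr_gt0// mulrC.
apply: (@le_trans _ _ (expR (1 / 32))).
  apply: (@le_trans _ _ (expR (delta / B%:R) ^+ D)).
    by rewrite lerXn2r ?nnegrE ?expR_ge0// expR_ge1Dx.
  by rewrite -expRM_natl ler_expR.
(* exp(1/32) <= 1 / (1 - 1/32) = 32/31 <= 17/16. *)
rewrite -[leLHS]invrK -expRN invf_ple ?posrE ?expR_gt0//.
  apply: le_trans (expR_ge1Dx _); lra.
Qed.

End BlockDesign.

Section BlockHits.
Context (R : realType) (n D B off : nat) (S : finType) (v : S -> R).
Hypothesis offDB : (off + D * B <= n)%N.
Variable base : n.-tuple R.
Implicit Type w : {ffun 'I_D -> 'I_B * S}.

Definition block_hits w : {set 'I_n} :=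
  [set block_pos offDB j (w j).1 | j : 'I_D].

Lemma card_block_hits w : #|block_hits w| = D.
Proof.
rewrite card_imset ?card_ord// => j j' /eqP.
by rewrite block_pos_eq => /andP[/eqP].
Qed.

Lemma block_pointE w i :
  (i \notin block_hits w /\ tnth (block_point v offDB base w) i = tnth base i) \/
  (i \in block_hits w /\
   exists c, tnth (block_point v offDB base w) i = tnth base i + v c).
Proof.
rewrite /block_point tnth_mktuple.
have [iH|iH] := boolP (i \in block_hits w); [right|left]; split=> //.
  have /imsetP[j _ ->] := iH.
  by exists (w j).2; rewrite block_shift_pos.
rewrite block_shift_out ?addr0// => j; apply: contra iH => /eqP <-.
exact: imset_f.
Qed.

Lemma block_hits_bounds w i : i \in block_hits w -> (off <= i < off + D * B)%N.
Proof.
move=> /imsetP[j _ ->] /=; rewrite leq_addr/= ltn_add2l.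
apply: (@leq_trans (j.+1 * B)); first by rewrite mulSn addnC ltn_add2r.
by rewrite leq_mul2r ltn_ord orbT.
Qed.

End BlockHits.

Lemma card_ord_lt n k : (k <= n)%N -> #|[pred i : 'I_n | (i < k)%N]| = k.
Proof.
move=> kn; rewrite -sum1_card -(big_ord_widen n (fun=> 1%N) kn).
by rewrite sum1_card card_ord.
Qed.

Lemma sum_unif (R : realType) (I : finType) : (0 < #|I|)%N ->
  \sum_(i : I) (#|I|%:R^-1 : R) = 1.
Proof. by move=> I0; rewrite sumr_const -[LHS]mulr_natr mulVf// pnatr_eq0 -lt0n. Qed.

Section BlockLowerBounds.
Context (R : realType) (s : R) (n : nat).
Hypothesis s_gt0 : 0 < s.

(** The null vector has its first k0 entries equal to a and the blocks lie after them. With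
    [expR l = 1 + u], averaging over the signs leaves cosh l - 1 <= u^2 / 2 instead of u, so that u
    of order sqrt n / D is allowed. *)
Lemma hard_blocks_signed (k0 D : nat) (l : R) : (0 < D)%N -> (D <= n - k0)%N ->
  (n <= 2 * (n - k0))%N ->
  l = ln (1 + Num.sqrt n%:R / (8 * D%:R)) ->
  hard s n k0 D (s * Num.sqrt l * Num.sqrt D%:R).
Proof.
move=> D0 Dn nk lE.
set u := _ / _ in lE.
have n0 : (0 < n)%N by lia.
have Dr0 : (0 : R) < D%:R by rewrite ltr0n.
have u0 : 0 < u by rewrite divr_gt0 ?sqrtr_gt0 ?ltr0n// mulr_gt0.
have l0 : 0 < l by rewrite lE ln_gt0// ltrDl.
have el : expR l = 1 + u by rewrite lE lnK// posrE addr_gt0.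
pose a := s * Num.sqrt l.
have a0 : 0 < a by rewrite mulr_gt0 ?sqrtr_gt0.
have a2 : a * a / s ^+ 2 = l.
  rewrite -expr2 exprMn sqr_sqrtr ?ltW// mulrAC divff ?mul1r//.
  by rewrite expf_neq0// gt_eqF.
pose B := ((n - k0) %/ D)%N.
have Bp : (0 < B)%N by rewrite divn_gt0.
have DB : (D * B <= n - k0)%N by rewrite mulnC leq_trunc_div.
have offDB : (k0 + D * B <= n)%N by lia.
(* n <= 2 (n - k0) < 2 (D B + D) <= 4 D B. *)
have nDB : (n <= 4 * (D * B))%N.
  have : (n - k0 < D * B + D)%N by rewrite mulnC -mulSnr ltn_ceil.
  by have := leq_pmulr D Bp; lia.
pose base : n.-tuple R := [tuple if (i < k0)%N then a else 0 | i < n].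
pose v (b : bool) := if b then a else - a.
pose Om := {ffun 'I_D -> 'I_B * bool}.
have Om0 : (0 < #|Om|)%N.
  by rewrite card_ffun card_prod !card_ord card_bool expn_gt0 muln_gt0 Bp.
have nz w i : (tnth (block_point v offDB base w) i != 0) =
    (i < k0)%N || (i \in block_hits offDB w).
  have [[iH ->]|[iH [c ->]]] := block_pointE v offDB base w i;
    rewrite tnth_mktuple.
    by rewrite (negPf iH) orbF; case: ifP; rewrite ?eqxx// gt_eqF.
  rewrite iH orbT ifF; last by have /andP[] := block_hits_bounds iH; rewrite leqNgt => /negPf.
  by rewrite add0r /v; case: c; rewrite ?oppr_eq0 gt_eqF.
have l0E w : l0norm (block_point v offDB base w) = (k0 + D)%N.
  rewrite /l0norm (eq_card (nz w)).
  transitivity (#|[pred i : 'I_n | (i < k0)%N]| + #|block_hits offDB w|)%N; last first.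
    by rewrite card_block_hits card_ord_lt//; lia.
  rewrite -cardUI [X in (_ + X)%N]eq_card0 ?addn0//.
  move=> i; rewrite !inE; apply/negP => /andP[ik /block_hits_bounds].
  by rewrite leqNgt ik.
have ha w i : tnth (block_point v offDB base w) i != 0 ->
    a <= `|tnth (block_point v offDB base w) i|.
  have [[iH ->]|[iH [c ->]]] := block_pointE v offDB base w i;
    rewrite tnth_mktuple.
    by case: ifP => _; rewrite ?eqxx// ger0_norm// ltW.
  rewrite ifF; last by have /andP[] := block_hits_bounds iH; rewrite leqNgt => /negPf.
  by rewrite add0r /v; case: c; rewrite ?normrN ger0_norm// ltW.
apply: (@hard_of_priors _ _ _ s_gt0 unit Om (fun=> 1) (fun=> #|Om|%:R^-1)
  (fun=> base) (block_point v offDB base) base predT predT).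
- by rewrite !mulr_gt0 ?sqrtr_gt0.
- by [].
- by rewrite sumr_const card_unit.
- by move=> _; rewrite invr_ge0.
- exact: sum_unif.
- left; apply: (@block_chi2 _ s n D B k0 _ v offDB base s_gt0 Bp _ (u ^+ 2 / 2)).
  + by rewrite card_bool.
  + rewrite !big_bool/= card_bool mulrN mulrNN !mulNr a2 expRN el.
    rewrite -subr_ge0 (_ : _ - _ = 2 * u ^+ 3 / (1 + u)).
      by rewrite divr_ge0 ?mulr_ge0 ?exprn_ge0// ?addr_ge0 ?ltW.
    by field; rewrite gt_eqF// addr_gt0.
  (* The left side is n / (128 D B), and 128 = 4 * 32: this fixes the 8 in [u]. *)
  + rewrite /u expr_div_n sqr_sqrtr//.
    rewrite [leLHS](_ : _ = n%:R / (128 * (D * B)%:R)).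
      rewrite ler_pdivrMr; last by rewrite mulr_gt0// ltr0n muln_gt0 D0.
      have : (n%:R : R) <= 4 * (D * B)%:R by rewrite -natrM ler_nat.
      lra.
    by rewrite natrM; field; rewrite !pnatr_eq0 -!lt0n D0 Bp.
- move=> _ _; rewrite /B0/= /l0norm.
  rewrite -[leqRHS](@card_ord_lt n k0); last lia.
  apply: subset_leq_card; apply/fintype.subsetP => i.
  by rewrite !inE tnth_mktuple; case: ifP; rewrite ?eqxx.
- move=> w _; apply: B0sep_mem; rewrite ?l0E//; first exact: ltW.
  exact: ha.
- by rewrite !big_pred0//; lra.
Qed.

(** Here the alternative is the point mass, with k0 + D entries equal to a, and the null erases one
    of them per block; the divergence is taken in the reverse direction. Erasing leaves no sign to
    average over, so the excess is [expR l - 1], which is u and not of order u^2. *)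
Lemma hard_blocks_removed (k0 D : nat) (l : R) : (0 < D)%N -> (D <= n - k0)%N ->
  (0 < k0)%N -> (k0 <= n)%N ->
  l = ln (1 + k0%:R / (32 * D%:R ^+ 2)) ->
  hard s n k0 D (s * Num.sqrt l * Num.sqrt D%:R).
Proof.
move=> D0 Dn k00 kn lE.
set u := _ / _ in lE.
have Dr0 : (0 : R) < D%:R by rewrite ltr0n.
have u0 : 0 < u by rewrite divr_gt0 ?ltr0n// mulr_gt0// exprn_gt0.
have l0 : 0 < l by rewrite lE ln_gt0// ltrDl.
have el : expR l = 1 + u by rewrite lE lnK// posrE addr_gt0.
pose a := s * Num.sqrt l.
have a0 : 0 < a by rewrite mulr_gt0 ?sqrtr_gt0.
have a2 : a * a / s ^+ 2 = l.
  rewrite -expr2 exprMn sqr_sqrtr ?ltW// mulrAC divff ?mul1r//.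
  by rewrite expf_neq0// gt_eqF.
pose N := (k0 + D)%N.
have Nn : (N <= n)%N by rewrite /N; lia.
pose B := (N %/ D)%N.
have Bp : (0 < B)%N by rewrite divn_gt0// /N; lia.
have DB : (D * B <= N)%N by rewrite mulnC leq_trunc_div.
have offDB : (0 + D * B <= n)%N by lia.
have kDB : (k0 <= D * B)%N.
  have : (N < D * B + D)%N by rewrite mulnC -mulSnr ltn_ceil.
  by rewrite /N; lia.
pose base : n.-tuple R := [tuple if (i < N)%N then a else 0 | i < n].
pose v (b : unit) := - a.
pose Om := {ffun 'I_D -> 'I_B * unit}.
have Om0 : (0 < #|Om|)%N.
  by rewrite card_ffun card_prod !card_ord card_unit expn_gt0 muln_gt0 Bp.
have l0base : l0norm base = N.
  rewrite /l0norm -[RHS](@card_ord_lt n N)//; apply: eq_card => i.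
  by rewrite !inE tnth_mktuple; case: ifP; rewrite ?eqxx// gt_eqF.
have l0w w : (l0norm (block_point v offDB base w) <= k0)%N.
  rewrite -(leq_add2r D) -[leqRHS](@card_ord_lt n N)//.
  (* Hit coordinates become zero, so the support and the hits are disjoint subsets of the first N
     coordinates. *)
  apply: (@leq_trans (l0norm (block_point v offDB base w) + #|block_hits offDB w|)).
    by rewrite card_block_hits.
  rewrite /l0norm -cardUI.
  rewrite [X in (_ + X)%N]eq_card0 ?addn0; last first.
    move=> i; rewrite !inE; have [[iH ->]|[iH [c ->]]] := block_pointE v offDB base w i.
      by rewrite (negPf iH) andbF.
    have /= iN := block_hits_bounds iH.
    by rewrite tnth_mktuple /v ifT ?subrr ?eqxx//; lia.
  apply: subset_leq_card; apply/fintype.subsetP => i; rewrite !inE.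
  have [[iH ->]|[iH _]] := block_pointE v offDB base w i.
    by rewrite (negPf iH) orbF tnth_mktuple; case: ifP; rewrite ?eqxx.
  by move=> _; have /= := block_hits_bounds iH; lia.
apply: (@hard_of_priors _ _ _ s_gt0 Om unit (fun=> #|Om|%:R^-1) (fun=> 1)
  (block_point v offDB base) (fun=> base) base predT predT).
- by rewrite !mulr_gt0 ?sqrtr_gt0.
- by move=> _; rewrite invr_ge0.
- exact: sum_unif.
- by [].
- by rewrite sumr_const card_unit.
- right; apply: (@block_chi2 _ s n D B 0 _ v offDB base s_gt0 Bp _ u).
  + by rewrite card_unit.
  + rewrite /v !sumr_const card_unit mulrNN a2 el mulr1n expr1n; lra.
  + rewrite [leLHS](_ : _ = k0%:R / (32 * (D * B)%:R)).
      rewrite ler_pdivrMr; last by rewrite mulr_gt0// ltr0n muln_gt0 D0.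
      have : (k0%:R : R) <= (D * B)%:R by rewrite ler_nat.
      lra.
    by rewrite natrM /u; field; rewrite !pnatr_eq0 -!lt0n D0 Bp.
- by move=> w _; exact: l0w.
- move=> _ _; apply: B0sep_mem; rewrite ?l0base//; first exact: ltW.
  by move=> i; rewrite tnth_mktuple; case: ifP => _; rewrite ?eqxx// ger0_norm// ltW.
- by rewrite !big_pred0//; lra.
Qed.

End BlockLowerBounds.

(** * Independent identically distributed designs *)

Section MixtureOfShifts.
Context (R : realType) (s : R) (I : finType).
Hypothesis s_gt0 : 0 < s.
Implicit Types (p t : I -> R).

Definition shift_mixture p t (x : R) : R := \sum_c p c * lratio s (t c) x.

Lemma measurable_shift_mixture p t :
  measurable_fun setT (shift_mixture p t : measurableTypeR R -> measurableTypeR R).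
Proof.
apply: measurable_sum => c; apply: measurable_funM => //.
exact: measurable_lratio.
Qed.

Lemma shift_mixture_ge p t c x : (forall c, 0 <= p c) ->
  p c * lratio s (t c) x <= shift_mixture p t x.
Proof.
move=> p0; rewrite /shift_mixture (bigD1 c)//= lerDl sumr_ge0// => c' _.
by rewrite mulr_ge0// lratio_ge0.
Qed.

Lemma shift_mixture_ge0 p t x : (forall c, 0 <= p c) -> 0 <= shift_mixture p t x.
Proof. by move=> p0; apply: sumr_ge0 => c _; rewrite mulr_ge0// lratio_ge0. Qed.

Lemma integral_shift_mixture p t : (forall c, 0 <= p c) -> \sum_c p c = 1 ->
  (\int[normal_prob 0 s]_x (shift_mixture p t x)%:E = 1)%E.
Proof.
move=> p0 p1.
transitivity (\int[normal_prob 0 s]_x (\sum_c (p c)%:E * (lratio s (t c) x)%:E))%E.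
  by apply: eq_integral => x _; under [RHS]eq_bigr do rewrite -EFinM; rewrite sumEFin.
rewrite ge0_integral_sum//; last 2 first.
- by move=> c; apply: measurable_funeM; apply/measurable_EFinP; exact: measurable_lratio.
- by move=> c x _; rewrite -EFinM lee_fin mulr_ge0// lratio_ge0.
rewrite -p1 -sumEFin; apply: eq_bigr => c _.
rewrite ge0_integralZl_EFin// ?integral_lratio ?gt_eqF ?mule1//.
- by move=> x _; rewrite lee_fin lratio_ge0.
- by apply/measurable_EFinP; exact: measurable_lratio.
Qed.

(** The weights may be negative, so the expansion is integrated through integrability of its terms
    instead of their positivity. *)
Lemma integral_shift_mixture_sqr (d t : I -> R) :
  (\int[normal_prob 0 s]_x (shift_mixture d t x ^+ 2)%:E =
   (\sum_c \sum_c' d c * d c' * expR (t c * t c' / s ^+ 2))%:E)%E.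
Proof.
pose h (cc : I * I) (x : measurableTypeR R) :=
  (lratio s (t cc.1) x * lratio s (t cc.2) x)%:E.
have inth cc : (normal_prob 0 s).-integrable setT (h cc).
  apply/integrableP; split.
    by apply/measurable_EFinP; apply: measurable_funM; exact: measurable_lratio.
  rewrite (eq_integral (h cc)); last first.
    by move=> x _; rewrite gee0_abs// lee_fin mulr_ge0// lratio_ge0.
  by rewrite /h integral_lratioM ?gt_eqF// ltry.
transitivity (\int[normal_prob 0 s]_x
    (\sum_(cc : I * I) (d cc.1 * d cc.2)%:E * h cc x))%E.
  apply: eq_integral => x _; rewrite /h.
  under [RHS]eq_bigr do rewrite -EFinM.
  rewrite sumEFin; congr _%:E; rewrite expr2 /shift_mixture big_distrlr/= pair_big/=.
  by apply: eq_bigr => -[c c'] _ /=; ring.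
rewrite integral_sum//; last by move=> cc; exact: integrableZl.
rewrite pair_big/= -sumEFin; apply: eq_bigr => cc _.
by rewrite integralZl// /h integral_lratioM// gt_eqF.
Qed.

(** The atom at 0 has density 1 and mass at least 1/4, so g0 >= 1/4 and the divergence is at most 4
    times the integral of (g1 - g0)^2. *)
Lemma shift_mixture_chi2 (p0 p1 t : I -> R) (c0 : I) :
  (forall c, 0 <= p0 c) -> \sum_c p0 c = 1 ->
  (forall c, 0 <= p1 c) -> \sum_c p1 c = 1 ->
  t c0 = 0 -> 1 / 4 <= p0 c0 ->
  (\int[normal_prob 0 s]_x (shift_mixture p1 t x ^+ 2 / shift_mixture p0 t x)%:E
   <= (1 + 4 * \sum_c \sum_c' (p1 c - p0 c) * (p1 c' - p0 c') *
         expR (t c * t c' / s ^+ 2))%:E)%E.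
Proof.
move=> p0_ge0 p0_sum p1_ge0 p1_sum tc0 pc0.
pose d c := p1 c - p0 c.
pose g0 := shift_mixture p0 t; pose g1 := shift_mixture p1 t.
pose g := shift_mixture d t.
have gE x : g x = g1 x - g0 x.
  by rewrite /g /g1 /g0 /shift_mixture -sumrB; apply: eq_bigr => c _; rewrite mulrBl.
have g0_ge x : 1 / 4 <= g0 x.
  apply: (le_trans _ (shift_mixture_ge t c0 x p0_ge0)).
  by rewrite tc0 lratio0 mulr1.
have g0_gt0 x : 0 < g0 x by have := g0_ge x; lra.
have g1_ge0 x : 0 <= g1 x by exact: shift_mixture_ge0.
have mg0 : measurable_fun setT (EFin \o g0).
  by apply/measurable_EFinP; exact: measurable_shift_mixture.
have mg1 : measurable_fun setT (EFin \o g1).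
  by apply/measurable_EFinP; exact: measurable_shift_mixture.
have mg : measurable_fun setT (EFin \o (fun x => g x ^+ 2)).
  by apply/measurable_EFinP; apply: measurable_funX; exact: measurable_shift_mixture.
have mq : measurable_fun setT (EFin \o (fun x => g1 x ^+ 2 / g0 x)).
  apply/measurable_EFinP; apply: measurable_funM.
    by apply: measurable_funX; exact: measurable_shift_mixture.
  by apply: measurable_inv_pos => //; exact: measurable_shift_mixture.
rewrite -/g0 -/g1; set E := \sum_c _.
have intg : (\int[normal_prob 0 s]_x (g x ^+ 2)%:E = E%:E)%E.
  exact: integral_shift_mixture_sqr.
have : (\int[normal_prob 0 s]_x ((g1 x ^+ 2 / g0 x)%:E + (g0 x)%:E) <=
  \int[normal_prob 0 s]_x (2%:E * (g1 x)%:E + 4%:E * (g x ^+ 2)%:E))%E.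
  apply: ge0_le_integral => //.
  - by move=> x _; rewrite -EFinD lee_fin addr_ge0 ?divr_ge0 ?sqr_ge0// ltW.
  - exact: emeasurable_funD.
  - by apply: emeasurable_funD; exact: measurable_funeM.
  move=> x _; rewrite -!EFinM -!EFinD lee_fin -subr_ge0 gE.
  rewrite (_ : _ - _ = (g1 x - g0 x) ^+ 2 * (4 * g0 x - 1) / g0 x).
    apply: divr_ge0; last exact: ltW.
    by apply: mulr_ge0; [exact: sqr_ge0|have := g0_ge x; lra].
  by field; rewrite gt_eqF.
rewrite ge0_integralD//; last 2 first.
- by move=> x _; rewrite lee_fin divr_ge0 ?sqr_ge0// ltW.
- by move=> x _; rewrite lee_fin ltW.
rewrite ge0_integralD//; last 4 first.
- by move=> x _; rewrite -EFinM lee_fin mulr_ge0.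
- exact: measurable_funeM.
- by move=> x _; rewrite -EFinM lee_fin mulr_ge0 ?sqr_ge0.
- exact: measurable_funeM.
rewrite !ge0_integralZl_EFin//; last 2 first.
- by move=> x _; rewrite lee_fin sqr_ge0.
- by move=> x _; rewrite lee_fin.
rewrite !integral_shift_mixture// mule1.
rewrite intg -EFinM -EFinD -leeBrDr// => /le_trans; apply.
by rewrite -EFinB lee_fin; lra.
Qed.

End MixtureOfShifts.

Section IidDesign.
Context (R : realType) (s : R) (n N : nat) (I : finType) (v : I -> R) (b : R).
Hypotheses (s_gt0 : 0 < s) (Nn : (N <= n)%N).
Implicit Types (p : I -> R) (w : {ffun 'I_n -> I}) (P : pred I).

Definition iid_prior p w : R := \prod_i p (w i).

Definition iid_base : n.-tuple R := [tuple if (i < N)%N then b else 0 | i < n].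

Definition iid_point w : n.-tuple R :=
  [tuple if (i < N)%N then v (w i) else 0 | i < n].

Definition iid_count P w : nat := #|[pred i : 'I_n | (i < N)%N && P (w i)]|.

Lemma iid_prior_ge0 p w : (forall c, 0 <= p c) -> 0 <= iid_prior p w.
Proof. by move=> p0; exact: prodr_ge0. Qed.

Lemma iid_prior_sum p : \sum_c p c = 1 -> \sum_w iid_prior p w = 1.
Proof.
by move=> p1; rewrite /iid_prior -(bigA_distr_bigA (fun=> p)) big1.
Qed.

Lemma prod_ord_lt (x : R) : \prod_(i < n) (if (i < N)%N then x else 1) = x ^+ N.
Proof. by rewrite -big_mkcond -(big_ord_widen n (fun=> x) Nn) prodr_const card_ord. Qed.

Lemma l0norm_iid_point w : l0norm (iid_point w) = iid_count (fun c => v c != 0) w.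
Proof.
apply: eq_card => i; rewrite !inE tnth_mktuple.
by case: ifP => _; rewrite ?eqxx.
Qed.

Lemma iid_mixtureE p x : \sum_c p c = 1 ->
  mixture s (iid_prior p) iid_point iid_base x =
  \prod_(i < n) (if (i < N)%N then shift_mixture s p (fun c => v c - b) (tnth x i)
                 else 1).
Proof.
move=> p1; rewrite /mixture.
transitivity (\sum_(w : {ffun 'I_n -> I}) \prod_(i < n) (p (w i) *
   (if (i < N)%N then lratio s (v (w i) - b) (tnth x i) else 1))).
  apply: eq_bigr => w _; rewrite /iid_prior /vlratio -big_split/=.
  apply: eq_bigr => i _; rewrite !tnth_mktuple; case: ifP => // _.
  by rewrite subrr lratio0.
rewrite -(bigA_distr_bigA (fun (i : 'I_n) c => p c *
  (if (i < N)%N then lratio s (v c - b) (tnth x i) else 1))).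
apply: eq_bigr => i _; case: ifP => // _.
by rewrite -[RHS]p1; apply: eq_bigr => c _; rewrite mulr1.
Qed.

Lemma iid_chi2 (p0 p1 : I -> R) (c0 : I) :
  (forall c, 0 <= p0 c) -> \sum_c p0 c = 1 ->
  (forall c, 0 <= p1 c) -> \sum_c p1 c = 1 ->
  v c0 = b -> 1 / 4 <= p0 c0 ->
  N%:R * (4 * \sum_c \sum_c' (p1 c - p0 c) * (p1 c' - p0 c') *
         expR ((v c - b) * (v c' - b) / s ^+ 2)) <= 1 / 32 ->
  chi2_close s (iid_prior p0) (iid_prior p1) iid_point iid_point iid_base.
Proof.
move=> p0_ge0 p0_sum p1_ge0 p1_sum vc0 pc0; set E := \sum_c _ => hE.
pose g p := shift_mixture s p (fun c => v c - b).
pose u (i : 'I_n) (x : measurableTypeR R) : R := if (i < N)%N then g p1 x ^+ 2 / g p0 x else 1.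
have g0_gt0 x : 0 < g p0 x.
  apply: (lt_le_trans _ (shift_mixture_ge s _ c0 x p0_ge0)).
  rewrite mulr_gt0 ?lratio_gt0//; lra.
have u_ge0 i x : 0 <= u i x.
  by rewrite /u; case: ifP => // _; rewrite divr_ge0 ?sqr_ge0// ltW.
have mu (i : 'I_n) : measurable_fun setT
    (u i : measurableTypeR R -> measurableTypeR R).
  rewrite /u; case: (i < N)%N => //; apply: measurable_funM.
    by apply: measurable_funX; exact: measurable_shift_mixture.
  by apply: measurable_inv_pos => //; exact: measurable_shift_mixture.
rewrite /chi2_close.
have -> : (\int[iid_power (normal_prob 0 s) n]_x
    (mixture s (iid_prior p1) iid_point iid_base x ^+ 2 /
     mixture s (iid_prior p0) iid_point iid_base x)%:E =
    \int[iid_power (normal_prob 0 s) n]_x (\prod_(i < n) u i (tnth x i))%:E)%E.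
  apply: eq_integral => x _; rewrite (iid_mixtureE x p1_sum) (iid_mixtureE x p0_sum).
  rewrite -prodrXl -prodf_div; congr _%:E.
  by apply: eq_bigr => i _; rewrite /u; case: ifP => // _; rewrite expr1n divr1.
rewrite (integral_iid_power_prod (normal_prob 0 s) mu u_ge0).
have chi := shift_mixture_chi2 s_gt0 p0_ge0 p0_sum p1_ge0 p1_sum
  (t := fun c => v c - b) (c0 := c0).
rewrite vc0 subrr in chi; have {}chi := chi erefl pc0.
have E0 : 0 <= 1 + 4 * E.
  rewrite -lee_fin; apply: le_trans chi; apply: integral_ge0 => x _.
  rewrite lee_fin; apply: divr_ge0; first exact: sqr_ge0.
  exact/ltW/g0_gt0.
apply: (@le_trans _ _ (\prod_(i < n) (if (i < N)%N then 1 + 4 * E else 1)%:E)%E).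
  suff : (0 <= \prod_(i < n) \int[normal_prob 0 s]_x (u i x)%:E <=
      \prod_(i < n) (if (i < N)%N then 1 + 4 * E else 1)%:E)%E by case/andP.
  apply: (big_ind2 (fun x y => (0 <= x <= y)%E)).
  - by rewrite lee01 lexx.
  - move=> x1 x2 y1 y2 /andP[x10 x12] /andP[y10 y12].
    by rewrite mule_ge0//= lee_pmul.
  - move=> i _; rewrite integral_ge0/=; last by move=> x _; rewrite lee_fin.
    rewrite /u; case: (i < N)%N => //.
    by rewrite integral_cst//= probability_setT mule1.
rewrite prodEFin prod_ord_lt lee_fin.
apply: (@le_trans _ _ (expR (1 / 32))).
  apply: (@le_trans _ _ (expR (4 * E) ^+ N)).
    by rewrite lerXn2r ?nnegrE ?expR_ge0// expR_ge1Dx.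
  by rewrite -expRM_natl ler_expR.
rewrite -[leLHS]invrK -expRN invf_ple ?posrE ?expR_gt0//.
apply: le_trans (expR_ge1Dx _); lra.
Qed.

(** The sign of [l] selects the tail: upper for l > 0, lower for l < 0. The exponent is that of a
    Poisson variable, from 1 + q (exp l - 1) <= exp(q (exp l - 1)). *)
Lemma iid_chernoff p P (l m : R) : (forall c, 0 <= p c) -> \sum_c p c = 1 ->
  \sum_(w | l * m <= l * (iid_count P w)%:R) iid_prior p w <=
  expR (N%:R * (\sum_(c | P c) p c) * (expR l - 1) - l * m).
Proof.
move=> p_ge0 p_sum; set q := \sum_(c | P c) p c.
pose e (i : 'I_n) c := if (i < N)%N && P c then expR l else 1 : R.
have eE w : \prod_(i < n) e i (w i) = expR (l * (iid_count P w)%:R).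
  rewrite /e -big_mkcond prodr_const -expRM_natr; congr (expR (_ * _%:R)).
have e0 i c : 0 <= e i c by rewrite /e; case: ifP => // _; exact: expR_ge0.
rewrite expRD expRN.
apply: (@le_trans _ _ (\sum_w iid_prior p w *
    (expR (l * (iid_count P w)%:R) / expR (l * m)))).
  rewrite big_mkcond; apply: ler_sum => w _.
  have pw := iid_prior_ge0 w p_ge0.
  case: ifP => h; last by rewrite !mulr_ge0 ?invr_ge0 ?expR_ge0.
  by rewrite ler_peMr// ler_pdivlMr ?expR_gt0// mul1r ler_expR.
under eq_bigr do rewrite mulrA -eE /iid_prior -big_split/=.
rewrite -mulr_suml ler_wpM2r ?invr_ge0 ?expR_ge0//.
rewrite -(bigA_distr_bigA (fun (i : 'I_n) c => p c * e i c)).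
apply: (@le_trans _ _ (\prod_(i < n) if (i < N)%N then expR (q * (expR l - 1)) else 1)).
  apply: ler_prod => i _; rewrite sumr_ge0/=; last by move=> c _; rewrite mulr_ge0.
  rewrite /e; case: (i < N)%N => /=; last first.
    by rewrite -[leRHS]p_sum; apply: ler_sum => c _; rewrite mulr1.
  apply: le_trans (expR_ge1Dx _); rewrite -[X in _ <= X + _]p_sum /q mulr_suml.
  rewrite [X in _ <= _ + X]big_mkcond -big_split/=; apply: ler_sum => c _.
  by case: ifP => _; rewrite ?addr0 ?mulr1//; lra.
by rewrite prod_ord_lt -expRM_natl mulrA.
Qed.

Lemma hard_iid (p0 p1 : I -> R) (c0 : I) (k0 D j : nat) (a : R) :
  (forall c, 0 <= p0 c) -> \sum_c p0 c = 1 ->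
  (forall c, 0 <= p1 c) -> \sum_c p1 c = 1 ->
  v c0 = b -> 1 / 4 <= p0 c0 ->
  N%:R * (4 * \sum_c \sum_c' (p1 c - p0 c) * (p1 c' - p0 c') *
         expR ((v c - b) * (v c' - b) / s ^+ 2)) <= 1 / 32 ->
  0 < a -> (0 < j)%N -> (forall c, v c != 0 -> a <= `|v c|) ->
  \sum_(w | ~~ (iid_count (fun c => v c != 0%R) w <= k0)%N) iid_prior p0 w +
  \sum_(w | ~~ (k0 + j <= iid_count (fun c => v c != 0%R) w <= k0 + D)%N)
    iid_prior p1 w < 1 / 4 ->
  hard s n k0 D (a * Num.sqrt j%:R).
Proof.
move=> p0_ge0 p0_sum p1_ge0 p1_sum vc0 pc0 hE a0 j0 va bad.
apply: (@hard_of_priors _ _ _ s_gt0 _ _ (iid_prior p0) (iid_prior p1)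
  iid_point iid_point iid_base _ _ _ _ _ _ _ _ _ _ _ _ _ bad) => //.
- by rewrite mulr_gt0// sqrtr_gt0 ltr0n.
- by move=> w; exact: iid_prior_ge0.
- exact: iid_prior_sum.
- by move=> w; exact: iid_prior_ge0.
- exact: iid_prior_sum.
- by left; exact: (iid_chi2 p0_ge0 p0_sum p1_ge0 p1_sum vc0 pc0 hE).
- by move=> w; rewrite /B0/= l0norm_iid_point.
- move=> w /andP[h1 h2]; apply: B0sep_mem; rewrite ?l0norm_iid_point//.
    exact: ltW.
  by move=> i; rewrite tnth_mktuple; case: ifP => _; rewrite ?eqxx//; exact: va.
Qed.

End IidDesign.

(** * Priors with matching moments *)

Section ExpTail.
Context (R : realType).
Implicit Types (y Y : R) (L k : nat).

Lemma expR1_le4 : expR 1 <= 4 :> R.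
Proof.
have h : expR (1 / 2) <= 2 :> R.
  rewrite -[leLHS]invrK -expRN invf_ple ?posrE ?expR_gt0//.
  by apply: le_trans (expR_ge1Dx _); lra.
rewrite (_ : 1 = 1 / 2 + 1 / 2 :> R); last lra.
rewrite expRD; apply: le_trans (ler_pM _ _ h h) _; rewrite ?expR_ge0//; lra.
Qed.

(** k^k / k! <= e^k <= 4^k, while Y^k <= (k / 16)^k. *)
Lemma exp_coeff_geom Y k : 0 <= Y -> (0 < k)%N -> 16 * Y <= k%:R ->
  Y ^+ k / k`!%:R <= (1 / 4) ^+ k.
Proof.
case: k => // k Y0 _ hY.
have k0 : (0 : R) < k.+1%:R by rewrite ltr0n.
have f0 : (0 : R) < k.+1`!%:R by rewrite ltr0n fact_gt0.
have h : k.+1%:R ^+ k.+1 / k.+1`!%:R <= 4 ^+ k.+1 :> R.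
  apply: (@le_trans _ _ (expR k.+1%:R)).
    apply: le_trans (expR_ge1Dxn k (ltW k0)); lra.
  rewrite -[X in expR X]mulr1 expRM_natl lerXn2r ?nnegrE ?expR_ge0//.
  exact: expR1_le4.
apply: (@le_trans _ _ ((k.+1%:R / 16) ^+ k.+1 / k.+1`!%:R)).
  rewrite ler_pM2r ?invr_gt0// lerXn2r ?nnegrE ?divr_ge0//.
  by rewrite ler_pdivlMr// mulrC.
rewrite expr_div_n mulrAC ler_pdivrMr ?exprn_gt0//.
rewrite -exprMn (_ : 1 / 4 * 16 = 4)//; lra.
Qed.

Lemma sum_geom_le (L n : nat) :
  \sum_(L <= k < n) (1 / 4 : R) ^+ k <= 4 / 3 * (1 / 4) ^+ L.
Proof.
suff h : (L <= n)%N -> \sum_(L <= k < n) (1 / 4 : R) ^+ k =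
    4 / 3 * ((1 / 4) ^+ L - (1 / 4) ^+ n).
  have [Ln|nL] := leqP L n.
    rewrite h// ler_pM2l; last lra.
    by rewrite gerBl exprn_ge0//; lra.
  by rewrite big_geq ?(ltnW nL)// mulr_ge0 ?exprn_ge0//; lra.
elim: n => [|n IH]; first by rewrite leqn0 => /eqP ->; rewrite big_geq// subrr mulr0.
rewrite leq_eqVlt => /predU1P[->|Ln]; first by rewrite big_geq// subrr mulr0.
by rewrite big_nat_recr//= IH// exprS; lra.
Qed.

Lemma exp_tail y Y L : `|y| <= Y -> (0 < L)%N -> 16 * Y <= L%:R ->
  `|expR y - \sum_(0 <= k < L) y ^+ k / k`!%:R| <= 4 / 3 * (1 / 4) ^+ L.
Proof.
move=> yY L0 YL; have Y0 : 0 <= Y by exact: le_trans yY.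
have cv : series (exp_coeff y) @ \oo --> expR y by exact: is_cvg_series_exp_coeff.
have cv2 : `|series (exp_coeff y) n - \sum_(0 <= k < L) y ^+ k / k`!%:R|
    @[n --> \oo] --> `|expR y - \sum_(0 <= k < L) y ^+ k / k`!%:R|.
  by apply: cvg_norm; apply: cvgB => //; exact: cvg_cst.
apply: (cvgr_to_le cv2).
near=> n.
have Ln : (L <= n)%N by near: n; exact: nbhs_infty_ge.
rewrite /series/= /exp_coeff/= (big_cat_nat _ (n := L))//= addrAC subrr add0r.
apply: le_trans (ler_norm_sum _ _ _) _.
apply: le_trans (sum_geom_le L n).
rewrite big_nat_cond [leRHS]big_nat_cond; apply: ler_sum => k /andP[/andP[Lk _] _].
have k0 : (0 < k)%N by exact: leq_trans Lk.
apply: le_trans (exp_coeff_geom Y0 k0 _); last first.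
  by apply: le_trans YL _; rewrite ler_nat.
rewrite normrM normrX normfV normr_nat ler_pM2r ?invr_gt0 ?ltr0n ?fact_gt0//.
by rewrite lerXn2r ?nnegrE.
Unshelve. all: by end_near.
Qed.

(** The vanishing moments kill the first L Taylor terms of exp(z z'); the remainder is uniformly
    bounded by a geometric tail. *)
Lemma signed_exp_bound (I : finType) (d z : I -> R) Y L :
  (forall k, (k < L)%N -> \sum_c d c * z c ^+ k = 0) ->
  (forall c, z c ^+ 2 <= Y) -> (0 < L)%N -> 16 * Y <= L%:R ->
  \sum_c \sum_c' d c * d c' * expR (z c * z c') <=
  (\sum_c `|d c|) ^+ 2 * (4 / 3 * (1 / 4) ^+ L).
Proof.
move=> mom zY L0 YL.
pose T y : R := \sum_(0 <= k < L) y ^+ k / k`!%:R.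
have T0 : \sum_c \sum_c' d c * d c' * T (z c * z c') = 0.
  rewrite (eq_bigr (fun c => \sum_(0 <= k < L) d c * z c ^+ k / k`!%:R *
     \sum_c' d c' * z c' ^+ k)); last first.
    move=> c _; rewrite (eq_bigr (fun c' => \sum_(0 <= k < L)
       d c * z c ^+ k / k`!%:R * (d c' * z c' ^+ k))).
      by rewrite exchange_big/=; apply: eq_bigr => k _; rewrite mulr_sumr.
    move=> c' _; rewrite /T mulr_sumr; apply: eq_bigr => k _.
    by rewrite exprMn; ring.
  apply: big1 => c _; rewrite big_nat_cond; apply: big1 => k /andP[/andP[_ kL] _].
  by rewrite mom// mulr0.
rewrite -[leLHS]subr0 -[X in _ - X <= _]T0 -sumrB.
rewrite expr2 big_distrlr/= mulr_suml; apply: ler_sum => c _.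
rewrite -sumrB mulr_suml; apply: ler_sum => c' _.
rewrite -mulrBr; apply: le_trans (ler_norm _) _.
rewrite 2!normrM; apply: ler_wpM2l; first exact: mulr_ge0.
apply: exp_tail (YL) => //.
have h1 := zY c; have h2 := zY c'.
have Y0 : 0 <= Y by apply: le_trans h1; exact: sqr_ge0.
rewrite -(@ler_pXn2r _ 2)// ?nnegrE// normrM exprMn !real_normK ?num_real//.
by rewrite expr2 ler_pM// sqr_ge0.
Qed.

End ExpTail.

(** * Chebyshev polynomials and extrapolation to 0 *)

Section Chebyshev.
Context (R : realType).

Fixpoint cheb (n : nat) : {poly R} :=
  match n with
  | 0 => 1
  | m.+1 => match m with
            | 0 => 'X
            | k.+1 => 2%:P * 'X * cheb m - cheb k
            end
  end.

Lemma chebSS n : cheb n.+2 = 2%:P * 'X * cheb n.+1 - cheb n.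
Proof. by []. Qed.

Lemma size_cheb n : (size (cheb n) <= n.+1)%N.
Proof.
suff : (size (cheb n) <= n.+1)%N /\ (size (cheb n.+1) <= n.+2)%N by case.
elim: n => [|n [h1 h2]]; first by rewrite size_poly1 size_polyX.
split=> //; rewrite chebSS; apply: leq_trans (size_polyD _ _) _.
rewrite geq_max size_polyN; apply/andP; split; last first.
  by apply: leq_trans h1 _; lia.
rewrite -mulrA mul_polyC; apply: leq_trans (size_scale_leq _ _) _.
by apply: leq_trans (size_polyMleq _ _) _; rewrite size_polyX.
Qed.

Lemma cheb_cos n t : (cheb n).[cos t] = cos (n%:R * t).
Proof.
suff : (cheb n).[cos t] = cos (n%:R * t) /\ (cheb n.+1).[cos t] = cos (n.+1%:R * t).
  by case.
elim: n => [|n [h1 h2]]; first by rewrite hornerE hornerX mul0r mul1r cos0.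
split=> //; rewrite chebSS !hornerE h1 h2.
have -> : n.+2%:R * t = n.+1%:R * t + t by rewrite -[n.+2]addn1 natrD mulrDl mul1r.
have -> : n%:R * t = n.+1%:R * t - t by rewrite -[n.+1]addn1 natrD mulrDl mul1r addrK.
by rewrite cosB cosD; ring.
Qed.

(** This evaluates [cheb n] outside [-1, 1], where [cheb_cos] does not reach. *)
Lemma cheb_joukowski n z : z != 0 ->
  (cheb n).[(z + z^-1) / 2] = (z ^+ n + z^-1 ^+ n) / 2.
Proof.
move=> z0.
suff : (cheb n).[(z + z^-1) / 2] = (z ^+ n + z^-1 ^+ n) / 2 /\
  (cheb n.+1).[(z + z^-1) / 2] = (z ^+ n.+1 + z^-1 ^+ n.+1) / 2 by case.
elim: n => [|n [h1 h2]]; first by rewrite hornerE hornerX !expr0 !expr1; split => //; lra.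
split=> //; rewrite chebSS !hornerE h1 h2 !exprSr.
by rewrite -!mulrA !mulrDl -!mulrA; field.
Qed.

End Chebyshev.

Section LagrangeAtZero.
Context (F : fieldType) (K : nat) (y : 'I_K.+1 -> F).
Hypothesis y_inj : injective y.

(** Value at 0 of the j-th Lagrange basis polynomial of the nodes [y]. *)
Definition lagrange0 (j : 'I_K.+1) : F :=
  \prod_(i < K.+1 | i != j) (y i / (y i - y j)).

(** The difference of [q] and its interpolant has size at most K + 1 and K + 1 roots, hence
    vanishes. *)
Lemma lagrange0P (q : {poly F}) : (size q <= K.+1)%N ->
  \sum_j lagrange0 j * q.[y j] = q.[0].
Proof.
move=> sq.
pose Lam (j : 'I_K.+1) : {poly F} :=
  \prod_(i < K.+1 | i != j) ((y i - y j)^-1 *: ((y i)%:P - 'X)).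
have LamE j : (Lam j).[y j] = 1.
  rewrite horner_prod big1// => i ij; rewrite !hornerE mulVf// subr_eq0.
  by apply: contra ij => /eqP /y_inj ->.
have Lam0 j i : i != j -> (Lam j).[y i] = 0.
  by move=> ij; rewrite horner_prod (bigD1 i)//= !hornerE subrr mulr0 mul0r.
have LamZ j : (Lam j).[0] = lagrange0 j.
  by rewrite horner_prod; apply: eq_bigr => i _; rewrite !hornerE subr0 mulrC.
have sLam j : (size (Lam j) <= K.+1)%N.
  apply: leq_trans (size_poly_prod_leq _ _) _.
  have h : (\sum_(i < K.+1 | i != j) size ((y i - y j)^-1 *: ((y i)%:P - 'X)) <=
      \sum_(i < K.+1 | i != j) 2)%N.
    apply: leq_sum => i _; apply: leq_trans (size_scale_leq _ _) _.
    by rewrite -opprB size_polyN size_XsubC.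
  have c : #|[pred i : 'I_K.+1 | i != j]| = K.
    transitivity #|predC1 j|; first by apply: eq_card => i; rewrite !inE.
    by rewrite cardC1 card_ord.
  rewrite sum_nat_const c in h; rewrite [X in (_ - X)%N](_ : _ = K)//.
  by rewrite leq_subLR addnS ltnS (leq_trans h)// muln2 -addnn.
pose r := q - \sum_j q.[y j] *: Lam j.
have r0 : r = 0.
  apply/eqP; apply: contraT => rn0.
  have := max_poly_roots rn0 (rs := [seq y j | j <- enum 'I_K.+1]).
  rewrite map_inj_uniq// enum_uniq size_map size_enum_ord => h.
  have : (K.+1 < size r)%N.
    apply: h => //; apply/allP => _ /mapP[i _ ->]; rewrite rootE /r !hornerE.
    rewrite horner_sum (bigD1 i)//= !hornerE LamE mulr1 big1 ?addr0 ?subrr//.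
    by move=> j ji; rewrite !hornerE Lam0 ?mulr0// eq_sym.
  rewrite ltnNge => /negP[]; apply: leq_trans (size_polyD _ _) _.
  rewrite geq_max sq size_polyN /=; apply: leq_trans (size_sum _ _ _) _.
  by apply/bigmax_leqP => j _; apply: leq_trans (size_scale_leq _ _) _.
have := congr1 (horner^~ 0) r0; rewrite /r !hornerE horner_sum => /eqP.
rewrite subr_eq0 => /eqP ->; apply: eq_bigr => j _.
by rewrite !hornerE LamZ mulrC.
Qed.

End LagrangeAtZero.

Section ChebyshevWeights.
Context (R : realType) (K : nat) (a M : R).
Hypotheses (K0 : (0 < K)%N) (a0 : 0 < a) (aM : a < M).

(** The extremal points cos(j pi / K) of the Chebyshev polynomial, carried to [a^2, M^2] with the
    orientation reversed so that nodes increase with j. *)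
Definition cheb_node (j : 'I_K.+1) : R :=
  ((M ^+ 2 + a ^+ 2) - (M ^+ 2 - a ^+ 2) * cos (j%:R * (pi / K%:R))) / 2.

Let dM : 0 < M ^+ 2 - a ^+ 2.
Proof. by rewrite subr_gt0 ltrXn2r// ltW// (lt_trans a0). Qed.

Let angle (j : 'I_K.+1) : j%:R * (pi / K%:R) \in `[0, pi : R].
Proof.
rewrite in_itv/= mulr_ge0 ?divr_ge0 ?pi_ge0//=.
rewrite mulrCA ler_piMr ?pi_ge0// ler_pdivrMr ?ltr0n// mul1r ler_nat.
by rewrite -ltnS.
Qed.

Lemma cheb_node_lt (i j : 'I_K.+1) : (i < j)%N -> cheb_node i < cheb_node j.
Proof.
move=> ij; rewrite /cheb_node ltr_pM2r ?invr_gt0// ltrD2l ltrN2 ltr_pM2l//.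
rewrite ltr_cos ?angle// ltr_pM2r ?ltr_nat// divr_gt0 ?pi_gt0 ?ltr0n//.
Qed.

Lemma cheb_node_inj : injective cheb_node.
Proof.
move=> i j e; case: (ltngtP i j) => [ij|ji|ij]; last exact: val_inj.
- by have := cheb_node_lt ij; rewrite e ltxx.
- by have := cheb_node_lt ji; rewrite e ltxx.
Qed.

Lemma cheb_node_bounds j : a ^+ 2 <= cheb_node j <= M ^+ 2.
Proof.
have h1 := cos_le1 (j%:R * (pi / K%:R) : R).
have h2 := cos_geN1 (j%:R * (pi / K%:R) : R).
have d := ltW dM.
move: h1 h2; rewrite /cheb_node; set x := cos _ => h1 h2.
have h3 : (M ^+ 2 - a ^+ 2) * x <= M ^+ 2 - a ^+ 2 by rewrite ler_piMr.
have h4 : - (M ^+ 2 - a ^+ 2) <= (M ^+ 2 - a ^+ 2) * x.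
  by rewrite -mulrN1 ler_wpM2l.
by apply/andP; split; lra.
Qed.

(** The nodes are positive and increasing, so the factor y_i / (y_i - y_j) is negative exactly for
    the j indices i < j. *)
Lemma sign_lagrange0 (j : 'I_K.+1) : 0 <= (-1) ^+ j * lagrange0 cheb_node j.
Proof.
have -> : (-1) ^+ j = \prod_(i < K.+1 | i != j) (if (i < j)%N then -1 else 1) :> R.
  transitivity (\prod_(i < K.+1) (if (i < j)%N then -1 else 1) : R).
    by rewrite -big_mkcond -(big_ord_widen K.+1 (fun=> -1)) ?prodr_const ?card_ord// ltnW.
  by rewrite (bigD1 j)//= ltnn mul1r.
rewrite /lagrange0 -big_split/=; apply: prodr_ge0 => i ij.
have yi : 0 <= cheb_node i.
  by have /andP[+ _] := cheb_node_bounds i; apply: le_trans; exact: sqr_ge0.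
case: ltngtP => [h|h|/val_inj h]; last by rewrite h eqxx in ij.
- rewrite mulN1r -mulrN -invrN opprB divr_ge0// subr_ge0 ltW//.
  exact: cheb_node_lt.
- by rewrite mul1r divr_ge0// subr_ge0 ltW// cheb_node_lt.
Qed.

(* The Chebyshev polynomial alternates at the nodes with the signs of the
   weights, so that its value at 0 is the total variation of the weights. *)
Lemma sum_abs_lagrange0 :
  \sum_j `|lagrange0 cheb_node j| <= ((M + a) / (M - a)) ^+ K.
Proof.
have M0 : 0 < M by exact: lt_trans a0 aM.
have Ma : 0 < M - a by rewrite subr_gt0.
(* [z] solves (z + 1/z) / 2 = (M^2 + a^2) / (M^2 - a^2), the image of 0 under [p], which maps
   [a^2, M^2] onto [-1, 1]. *)
pose z := (M + a) / (M - a).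
have z1 : 1 <= z by rewrite /z ler_pdivlMr// mul1r lerD2l (le_trans _ (ltW a0))// oppr_le0 ltW.
pose p := (M ^+ 2 - a ^+ 2)^-1 *: ((M ^+ 2 + a ^+ 2)%:P - 2%:P * 'X).
have pE x : p.[x] = (M ^+ 2 + a ^+ 2 - 2 * x) / (M ^+ 2 - a ^+ 2).
  by rewrite /p !hornerE mulrC.
pose q := cheb R K \Po p.
have sq : (size q <= K.+1)%N.
  have s2 : (size p <= 2)%N.
    apply: leq_trans (size_scale_leq _ _) _.
    apply: leq_trans (size_polyD _ _) _; rewrite geq_max size_polyN mul_polyC.
    apply/andP; split; first by apply: leq_trans (size_polyC_leq1 _) _.
    by apply: leq_trans (size_scale_leq _ _) _; rewrite size_polyX.
  apply: leq_trans (size_comp_poly_leq _ _) _; rewrite ltnS.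
  have sc := size_cheb R K.
  apply: (@leq_trans (K * 1)); last by rewrite muln1.
  by apply: leq_mul; rewrite -subn1 leq_subLR add1n.
have qj j : q.[cheb_node j] = (-1) ^+ j.
  rewrite horner_comp pE (_ : _ / _ = cos (j%:R * (pi / K%:R))); last first.
    by rewrite /cheb_node; field; rewrite gt_eqF.
  rewrite cheb_cos (_ : K%:R * _ = j%:R * pi); last first.
    by field; rewrite pnatr_eq0 -lt0n.
  elim: (val j) => [|m IH]; first by rewrite mul0r cos0 expr0.
  by rewrite -addn1 natrD mulrDl mul1r cosDpi IH addn1 exprS mulN1r.
have q0 : q.[0] <= z ^+ K.
  rewrite horner_comp pE (_ : _ / _ = (z + z^-1) / 2); last first.
    by rewrite /z; field; rewrite !gt_eqF// addr_gt0.
  rewrite cheb_joukowski; last by rewrite gt_eqF// (lt_le_trans ltr01).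
  have : z^-1 ^+ K <= 1 by rewrite exprn_ile1 ?invr_ge0 ?invf_le1//; lra.
  have : 1 <= z ^+ K by exact: exprn_ege1.
  lra.
rewrite (eq_bigr (fun j => lagrange0 cheb_node j * q.[cheb_node j])).
  by rewrite (lagrange0P cheb_node_inj sq).
move=> j _; rewrite qj mulrC -[RHS]ger0_norm ?sign_lagrange0//.
by rewrite normrM normrX normrN1 expr1n mul1r.
Qed.

Lemma lagrange0_ratio_le : 2 * a <= M ->
  ((M + a) / (M - a)) ^+ K <= expR (4 * K%:R * a / M).
Proof.
move=> aM2; have M0 : 0 < M by exact: lt_trans a0 aM.
have Ma : 0 < M - a by rewrite subr_gt0.
have -> : 4 * K%:R * a / M = K%:R * (4 * a / M) by field; rewrite gt_eqF.
rewrite expRM_natl; apply: lerXn2r.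
- by rewrite nnegrE; apply: divr_ge0; [apply: addr_ge0; exact: ltW|exact: ltW].
- by rewrite nnegrE expR_ge0.
apply: le_trans (expR_ge1Dx _).
rewrite ler_pdivrMr// -subr_ge0.
rewrite (_ : _ - _ = 2 * a * (M - 2 * a) / M).
  by apply: divr_ge0; [apply: mulr_ge0; rewrite ?subr_ge0// mulr_ge0// ltW|exact: ltW].
by field; rewrite gt_eqF.
Qed.

End ChebyshevWeights.

(** * The pair of laws of a coordinate *)

Section MomentMatching.
Context (R : realType) (K : nat) (a M w b : R).
Hypotheses (K0 : (0 < K)%N) (a0 : 0 < a) (aM : 2 * a <= M).
Hypotheses (w0 : 0 <= w) (w1 : w <= 1) (bM : `|b| <= M) (ba : b != 0 -> a <= `|b|).

Let aM' : a < M. Proof. by apply: lt_le_trans aM; rewrite ltr_pMl// ltr1n. Qed.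

Let l := lagrange0 (@cheb_node R K a M).

(** The weights sum to 1, so this is the sum of their positive parts; their negative parts sum to
    [mm_mass - 1]. *)
Definition mm_mass : R := (\sum_j `|l j| + 1) / 2.

(* [inl true] is the common atom b, [inl false] the atom 0, and
   [inr (j, e)] the square root, with sign e, of the j-th Chebyshev node. *)
Definition mm_index : finType := (bool + 'I_K.+1 * bool)%type.

Definition mm_value (c : mm_index) : R :=
  match c with
  | inl e => if e then b else 0
  | inr (j, e) => if e then Num.sqrt (cheb_node a M j) else - Num.sqrt (cheb_node a M j)
  end.

(** Positive parts of the weights here, negative parts and an atom at 0 in [mm_prior0], split evenly
    between the two signs. The difference of the two is w / [mm_mass] times the symmetrised Lagrange
    rule minus evaluation at 0. *)
Definition mm_prior1 (c : mm_index) : R :=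
  match c with
  | inl e => if e then 1 - w else 0
  | inr (j, _) => w * (`|l j| + l j) / (4 * mm_mass)
  end.

Definition mm_prior0 (c : mm_index) : R :=
  match c with
  | inl e => if e then 1 - w else w / mm_mass
  | inr (j, _) => w * (`|l j| - l j) / (4 * mm_mass)
  end.

Lemma sum_lagrange : \sum_j l j = 1.
Proof.
have := lagrange0P (cheb_node_inj K0 a0 aM') (q := 1).
rewrite size_poly1 hornerC => <- //; apply: eq_bigr => j _.
by rewrite hornerC mulr1.
Qed.

Lemma sum_abs_ge1 : 1 <= \sum_j `|l j|.
Proof. by rewrite -sum_lagrange; apply: ler_sum => j _; exact: ler_norm. Qed.

Lemma mm_mass_ge1 : 1 <= mm_mass.
Proof. by rewrite /mm_mass; have := sum_abs_ge1; lra. Qed.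

Lemma mm_mass_gt0 : 0 < mm_mass.
Proof. exact: lt_le_trans ltr01 mm_mass_ge1. Qed.

Lemma mm_mass_le : mm_mass <= expR (4 * K%:R * a / M).
Proof.
apply: le_trans (lagrange0_ratio_le K a0 aM' aM).
apply: le_trans (sum_abs_lagrange0 K0 a0 aM').
by rewrite /mm_mass; have := sum_abs_ge1; rewrite -/l; lra.
Qed.

Lemma mm_sum (F : mm_index -> R) :
  \sum_c F c = F (inl true) + F (inl false) +
    \sum_j (F (inr (j, true)) + F (inr (j, false))).
Proof.
rewrite big_sumType/= big_bool; congr (_ + _).
transitivity (\sum_j \sum_(e : bool) F (inr (j, e))).
  by rewrite pair_bigA; apply: eq_bigr => -[j e].
by apply: eq_bigr => j _; rewrite big_bool.
Qed.

Lemma mm_prior1_ge0 c : 0 <= mm_prior1 c.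
Proof.
have Z := mm_mass_gt0.
case: c => [[]|[j e]] //=; first by rewrite subr_ge0.
have h := ler_norm (- l j); rewrite normrN in h.
apply: divr_ge0; last by apply: mulr_ge0 => //; exact: ltW.
by apply: mulr_ge0 => //; lra.
Qed.

Lemma mm_prior0_ge0 c : 0 <= mm_prior0 c.
Proof.
have Z := mm_mass_gt0.
case: c => [[]|[j e]] /=; first by rewrite subr_ge0.
  by apply: divr_ge0 => //; exact: ltW.
have h := ler_norm (l j).
apply: divr_ge0; last by apply: mulr_ge0 => //; exact: ltW.
by apply: mulr_ge0 => //; lra.
Qed.

Lemma sum_split : \sum_j (`|l j| + l j) = 2 * mm_mass /\
  \sum_j (`|l j| - l j) = 2 * mm_mass - 2.
Proof.
by rewrite sumrB big_split/= sum_lagrange /mm_mass; split; lra.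
Qed.

Lemma mm_prior1_nodes :
  \sum_j (mm_prior1 (inr (j, true)) + mm_prior1 (inr (j, false))) = w.
Proof.
have Z := mm_mass_gt0; have [h1 _] := sum_split.
rewrite (eq_bigr (fun j => w / (2 * mm_mass) * (`|l j| + l j))); last first.
  by move=> j _ /=; field; rewrite gt_eqF.
by rewrite -mulr_sumr h1; field; rewrite gt_eqF.
Qed.

Lemma mm_prior0_nodes :
  \sum_j (mm_prior0 (inr (j, true)) + mm_prior0 (inr (j, false))) =
  w * (1 - mm_mass^-1).
Proof.
have Z := mm_mass_gt0; have [_ h2] := sum_split.
rewrite (eq_bigr (fun j => w / (2 * mm_mass) * (`|l j| - l j))); last first.
  by move=> j _ /=; field; rewrite gt_eqF.
by rewrite -mulr_sumr h2; field; rewrite gt_eqF.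
Qed.

Lemma mm_prior1_sum : \sum_c mm_prior1 c = 1.
Proof. by rewrite mm_sum mm_prior1_nodes /=; lra. Qed.

Lemma mm_prior0_sum : \sum_c mm_prior0 c = 1.
Proof. by rewrite mm_sum mm_prior0_nodes /=; lra. Qed.

Lemma mm_node_value_bounds (j : 'I_K.+1) : a <= Num.sqrt (cheb_node a M j) <= M.
Proof.
have /andP[h1 h2] := cheb_node_bounds a0 aM' j.
have M0 : 0 < M by exact: lt_trans a0 aM'.
have ea : a = Num.sqrt (a ^+ 2) by rewrite sqrtr_sqr ger0_norm// ltW.
have eM : M = Num.sqrt (M ^+ 2) by rewrite sqrtr_sqr ger0_norm// ltW.
by rewrite [X in X <= _ <= _]ea [X in _ <= _ <= X]eM !ler_wsqrtr.
Qed.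

Lemma mm_value_le c : `|mm_value c| <= M.
Proof.
have M0 : 0 < M by exact: lt_trans a0 aM'.
case: c => [[]|[j e]] //=; first by rewrite normr0 ltW.
have /andP[_ h] := mm_node_value_bounds j.
by case: e; rewrite ?normrN ger0_norm ?sqrtr_ge0.
Qed.

Lemma mm_value_ge c : mm_value c != 0 -> a <= `|mm_value c|.
Proof.
case: c => [[]|[j e]] //=; first by rewrite eqxx.
have /andP[h _] := mm_node_value_bounds j.
by case: e => _; rewrite ?normrN ger0_norm ?sqrtr_ge0.
Qed.

Lemma mm_node_value_neq0 (j : 'I_K.+1) (e : bool) : mm_value (inr (j, e)) != 0.
Proof.
have /andP[h _] := mm_node_value_bounds j.
by case: e => /=; rewrite ?oppr_eq0 gt_eqF// (lt_le_trans a0).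
Qed.

(** An even power of a value is a power m <= K of the node, on which extrapolation to 0 is exact;
    odd powers cancel between the signs. *)
Lemma mm_moment k : (k < K.*2.+2)%N ->
  \sum_c (mm_prior1 c - mm_prior0 c) * mm_value c ^+ k = 0.
Proof.
move=> kK; have Z := mm_mass_gt0; rewrite mm_sum /= subrr mul0r add0r sub0r.
rewrite (eq_bigr (fun j => w / (2 * mm_mass) * (l j *
  (Num.sqrt (cheb_node a M j) ^+ k + (- Num.sqrt (cheb_node a M j)) ^+ k)))); last first.
  by move=> j _; field; rewrite gt_eqF.
rewrite -mulr_sumr.
suff -> : \sum_j l j *
  (Num.sqrt (cheb_node a M j) ^+ k + (- Num.sqrt (cheb_node a M j)) ^+ k) = 2 * 0 ^+ k.
  by field; rewrite gt_eqF.
have [m [kE|kE]] : exists m, k = m.*2 \/ k = m.*2.+1.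
- exists k./2; rewrite -{1 3}(odd_double_half k).
  by case: (odd k); [right|left].
- rewrite kE; have mK : (m <= K)%N by lia.
  have := lagrange0P (cheb_node_inj K0 a0 aM') (q := 'X^m).
  rewrite size_polyXn hornerXn ltnS => /(_ mK) h.
  (* For m = 0 both sides are 1: this case is the equality of total masses. *)
  have -> : (0 : R) ^+ m.*2 = 0 ^+ m by rewrite !expr0n double_eq0.
  rewrite -h mulr_sumr; apply: eq_bigr => j _.
  rewrite hornerXn -mul2n !exprM sqrrN sqr_sqrtr; first by rewrite -/l; ring.
  by have /andP[+ _] := cheb_node_bounds a0 aM' j; apply: le_trans; exact: sqr_ge0.
- rewrite kE expr0n/= mulr0 big1// => j _.
  by rewrite exprNn -signr_odd/= odd_double/= expr1 mulN1r subrr mulr0.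
Qed.

(** Moments about b are the relevant ones, because the reference Gaussian is centred at the common
    atom. *)
Lemma mm_centered_moment k : (k < K.*2.+2)%N ->
  \sum_c (mm_prior1 c - mm_prior0 c) * (mm_value c - b) ^+ k = 0.
Proof.
move=> kK.
under eq_bigr do rewrite exprBn mulr_sumr.
rewrite exchange_big/=; apply: big1 => i _.
rewrite (eq_bigr (fun c => (-1) ^+ i * b ^+ i *+ 'C(k, i) *
  ((mm_prior1 c - mm_prior0 c) * mm_value c ^+ (k - i)))).
  by rewrite -mulr_sumr mm_moment ?mulr0//; lia.
by move=> c _; rewrite mulrnAr mulrnAl; congr (_ *+ _); ring.
Qed.

Lemma sum_absE : \sum_j `|l j| = 2 * mm_mass - 1.
Proof. by rewrite /mm_mass mulrCA divff ?mulr1 ?addrK// pnatr_eq0. Qed.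

Lemma mm_variation : \sum_c `|mm_prior1 c - mm_prior0 c| = 2 * w.
Proof.
have Z := mm_mass_gt0.
rewrite mm_sum.
rewrite /= subrr normr0 add0r sub0r normrN.
rewrite (ger0_norm (divr_ge0 w0 (ltW Z))).
rewrite (eq_bigr (fun j => w / mm_mass * `|l j|)).
  have -> : \sum_j w / mm_mass * `|l j| = w / mm_mass * (2 * mm_mass - 1).
    by rewrite -mulr_sumr sum_absE.
  by move: mm_mass Z => m Z; field; rewrite gt_eqF.
move=> j _; have -> : w * (`|l j| + l j) / (4 * mm_mass) -
    w * (`|l j| - l j) / (4 * mm_mass) = w / (2 * mm_mass) * l j.
  by field; rewrite gt_eqF.
rewrite normrM ger0_norm; first by field; rewrite gt_eqF.
by rewrite divr_ge0// mulr_ge0// ltW.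
Qed.

Lemma mm_nonzero1 : \sum_(c | mm_value c != 0) mm_prior1 c =
  w + (1 - w) *+ (b != 0).
Proof.
rewrite big_mkcond mm_sum.
rewrite (eq_bigr (fun j => mm_prior1 (inr (j, true)) + mm_prior1 (inr (j, false)))).
  by rewrite mm_prior1_nodes /= eqxx/= addr0 addrC; case: (b != 0).
by move=> j _; rewrite !mm_node_value_neq0.
Qed.

Lemma mm_zero0 : \sum_(c | mm_value c == 0) mm_prior0 c =
  w / mm_mass + (1 - w) *+ (b == 0).
Proof.
rewrite big_mkcond mm_sum big1.
  by rewrite /= eqxx addr0 addrC; case: (b == 0).
by move=> j _; rewrite !(negPf (mm_node_value_neq0 _ _)) addr0.
Qed.

End MomentMatching.

(** * Lower bounds *)

Section SumSubpred.
Context (R : numDomainType) (I : finType) (p : I -> R).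
Hypothesis p_ge0 : forall i, 0 <= p i.

Lemma ler_sum_subpred (S S' : pred I) : (forall i, S i -> S' i) ->
  \sum_(i | S i) p i <= \sum_(i | S' i) p i.
Proof.
move=> SS'; rewrite big_mkcond [leRHS]big_mkcond; apply: ler_sum => i _.
have [/SS' ->|_] := ifP (S i); first by [].
by case: ifP.
Qed.

Lemma ler_sum_predU (S S' : pred I) :
  \sum_(i | S i || S' i) p i <= \sum_(i | S i) p i + \sum_(i | S' i) p i.
Proof.
rewrite big_mkcond [X in _ <= X + _]big_mkcond [X in _ <= _ + X]big_mkcond.
rewrite -big_split/=; apply: ler_sum => i _.
by case: (S i); case: (S' i); rewrite ?addr0 ?add0r ?lerDl.
Qed.

End SumSubpred.

(** * I.i.d. priors in the dense and in the sparse regime *)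

Section MomentLowerBounds.
Context (R : realType) (s : R) (n : nat).
Hypothesis s_gt0 : 0 < s.

(** As w <= 3/4, the common atom keeps mass 1/4. Values are within 2 M of b, so the tail bound with
    L = 2K + 2 asks for 64 M^2 / s^2 <= 2K + 2; it yields 4 (2w)^2 (4/3) 4^-(2K+2) = w^2 (4/3) 16^-K
    per coordinate. *)
Lemma hard_moment (N k0 D j K : nat) (a M w b : R) :
  (N <= n)%N -> (0 < K)%N -> 0 < a -> 2 * a <= M ->
  0 <= w -> w <= 3 / 4 -> `|b| <= M -> (b != 0 -> a <= `|b|) ->
  32 * M ^+ 2 <= s ^+ 2 * K%:R ->
  N%:R * w ^+ 2 * (4 / 3) * (1 / 16) ^+ K <= 1 / 32 ->
  (0 < j)%N ->
  \sum_(f : {ffun 'I_n -> mm_index K} |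
      ~~ (iid_count N (fun c => mm_value a M b c != 0%R) f <= k0)%N)
    iid_prior (mm_prior0 a M w) f +
  \sum_(f : {ffun 'I_n -> mm_index K} |
      ~~ (k0 + j <= iid_count N (fun c => mm_value a M b c != 0%R) f <= k0 + D)%N)
    iid_prior (mm_prior1 a M w) f < 1 / 4 ->
  hard s n k0 D (a * Num.sqrt j%:R).
Proof.
move=> Nn K0 a0 aM w0 w34 bM ba MK chi j0 bad.
have w1 : w <= 1 by lra.
have M0 : 0 < M by lra.
apply: (hard_iid s_gt0 Nn (c0 := inl true) _ _ _ _ erefl _ _ a0 j0 _ bad).
- by move=> c; exact: mm_prior0_ge0.
- exact: mm_prior0_sum.
- by move=> c; exact: mm_prior1_ge0.
- exact: mm_prior1_sum.
- by rewrite /=; lra.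
- pose z (c : mm_index K) := (mm_value a M b c - b) / s : R.
  set S := \sum_c _.
  have SE : S = \sum_(c : mm_index K) \sum_(c' : mm_index K)
      (mm_prior1 a M w c - mm_prior0 a M w c) *
      (mm_prior1 a M w c' - mm_prior0 a M w c') * expR (z c * z c').
    apply: eq_bigr => c _; apply: eq_bigr => c' _; congr (_ * expR _).
    by rewrite /z /=; field; rewrite gt_eqF.
  have h := @signed_exp_bound R (mm_index K)
    (fun c => mm_prior1 a M w c - mm_prior0 a M w c) z (4 * M ^+ 2 / s ^+ 2) K.*2.+2.
  have : S <= (\sum_(c : mm_index K) `|mm_prior1 a M w c - mm_prior0 a M w c|) ^+ 2 *
      (4 / 3 * (1 / 4) ^+ K.*2.+2).
    rewrite SE; apply: h => //.
    + move=> k kK; rewrite (eq_bigr (fun c => (s ^- k) *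
        ((mm_prior1 a M w c - mm_prior0 a M w c) * (mm_value a M b c - b) ^+ k))).
        by rewrite -mulr_sumr mm_centered_moment ?mulr0.
      by move=> c _; rewrite /z expr_div_n; ring.
    + move=> c; rewrite /z expr_div_n ler_pM2r ?invr_gt0 ?exprn_gt0//.
      rewrite -real_normK ?num_real// (_ : 4 * M ^+ 2 = (2 * M) ^+ 2); last ring.
      rewrite lerXn2r ?nnegrE//; first by rewrite mulr_ge0// ltW.
      apply: le_trans (ler_normB _ _) _.
      by have := mm_value_le a0 aM bM c; lra.
    + rewrite mulrA ler_pdivrMr ?exprn_gt0//.
      have s2 : 0 < s ^+ 2 by rewrite exprn_gt0.
      have -> : (K.*2.+2%:R : R) = 2 * K%:R + 2.
        by rewrite -addn2 natrD -muln2 natrM mulrC.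
      rewrite mulrDl; have : 0 < 2 * s ^+ 2 by lra.
      lra.
  rewrite mm_variation// => hS.
  apply: le_trans chi; rewrite -[leRHS]mulrA -[leRHS]mulrA ler_wpM2l//.
  have -> : w ^+ 2 * (4 / 3 * (1 / 16) ^+ K) =
      4 * ((2 * w) ^+ 2 * (4 / 3 * (1 / 4) ^+ K.*2.+2)).
    rewrite -[K.*2.+2]addn2 -mul2n exprD exprM.
    have -> : (1 / 4) ^+ 2 = 1 / 16 :> R by field.
    by field.
  lra.
- move=> c; exact: mm_value_ge.
Qed.

Lemma expR_le_inv (l : R) : l < 1 -> expR l <= (1 - l)^-1.
Proof.
move=> l1; rewrite -[leLHS]invrK -expRN lef_pV2 ?posrE ?expR_gt0 ?subr_gt0//.
by have := expR_ge1Dx (- l).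
Qed.

Lemma expR_quad (l : R) : l <= 1 / 2 -> expR l - 1 <= l + 2 * l ^+ 2.
Proof.
move=> l2; have l1 : l < 1 by lra.
rewrite lerBlDr; apply: le_trans (expR_le_inv l1) _.
rewrite -[leLHS]mul1r ler_pdivrMr ?subr_gt0//.
have : 0 <= l ^+ 2 * (1 - 2 * l) by rewrite mulr_ge0 ?sqr_ge0//; lra.
lra.
Qed.

Lemma expRN_div_le (x : R) (m : nat) : m%:R <= x -> expR (- x) <= 1 / m.+1%:R.
Proof.
move=> mx; rewrite expRN div1r lef_pV2 ?posrE ?expR_gt0 ?ltr0n//.
by apply: le_trans (expR_ge1Dx _); rewrite -natr1 addrC lerD2l.
Qed.

Lemma ltr_inv_nat (m p : nat) : (0 < p)%N -> (p < m)%N -> 1 / m%:R < 1 / p%:R :> R.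
Proof.
by move=> p0 pm; rewrite !div1r ltf_pV2 ?posrE ?ltr0n ?ltr_nat//; exact: leq_trans pm.
Qed.

(** Chernoff exponent at l = -1/36 for the event that the number of zeros, of mean at least 9/8 D,
    is at most D. *)
Lemma dense_exponent (D q : R) : 0 <= D -> 9 / 8 * D <= q ->
  q * (expR (- (1 / 36)) - 1) - - (1 / 36) * D <= - (D / 576).
Proof.
move=> D0 Dq; have h : expR (- (1 / 36)) - 1 <= - (34 / 1296) :> R.
  by apply: le_trans (expR_quad _) _; lra.
have q0 : 0 <= q by lra.
have := ler_wpM2l q0 h; lra.
Qed.

(** D / (16 k) minimises - D l / 4 + 2 l^2 k, the bound on the exponent when the mean is D / 4 below
    the threshold k. *)
Lemma sparse_exponent_null (k D q : R) : 0 < D -> D <= k -> 0 <= q ->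
  q <= k - D / 4 ->
  q * (expR (D / (16 * k)) - 1) - D / (16 * k) * k <= - (D ^+ 2 / k / 128).
Proof.
move=> D0 Dk q0 qk; have k0 : 0 < k by lra.
set l := D / (16 * k).
have l0 : 0 < l by rewrite divr_gt0// mulr_gt0.
have l2 : l <= 1 / 2 by rewrite /l ler_pdivrMr ?mulr_gt0//; lra.
have h1 := ler_wpM2l q0 (expR_quad l2).
have h2 : q * (l + 2 * l ^+ 2) <= (k - D / 4) * (l + 2 * l ^+ 2).
  by rewrite ler_wpM2r// addr_ge0 ?(ltW l0)// mulr_ge0 ?sqr_ge0.
have h3 : 0 <= D * l ^+ 2 by rewrite mulr_ge0 ?sqr_ge0// ltW.
have h4 : - (D * l / 4) + 2 * l ^+ 2 * k = - (D ^+ 2 / k / 128).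
  by rewrite /l; field; rewrite gt_eqF.
lra.
Qed.

(** [x] is the direction of the tail. The mean is now at most 2 k, so the bound to minimise is - D l
    / 4 + 4 l^2 k, whence l = D / (32 k). *)
Lemma sparse_exponent_alt (k D x y : R) : 0 < D -> D <= k -> x = 1 \/ x = -1 ->
  x * (k + 3 / 4 * D) <= x * y - D / 4 ->
  (k + 3 / 4 * D) * (expR (x * (D / (32 * k))) - 1) - x * (D / (32 * k)) * y
    <= - (D ^+ 2 / k / 256).
Proof.
move=> D0 Dk x1 xy; have k0 : 0 < k by lra.
set l := D / (32 * k).
have l0 : 0 < l by rewrite divr_gt0// mulr_gt0.
have l2 : l <= 1 / 2 by rewrite /l ler_pdivrMr ?mulr_gt0//; lra.
have xl2 : x * l <= 1 / 2 by case: x1 => ->; lra.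
have x2 : (x * l) ^+ 2 = l ^+ 2.
  by case: x1 => ->; ring.
have m0 : 0 <= k + 3 / 4 * D by lra.
have h1 := ler_wpM2l m0 (expR_quad xl2); rewrite x2 in h1.
have h2 := ler_wpM2l (ltW l0) xy.
have h3 : 0 <= l ^+ 2 * (k - 3 / 4 * D) by rewrite mulr_ge0 ?sqr_ge0//; lra.
have h4 : - (D * l / 4) + 4 * l ^+ 2 * k = - (D ^+ 2 / k / 256).
  by rewrite /l; field; rewrite gt_eqF.
lra.
Qed.

(** 171 is the first integer above 32 * 16 / 3. *)
Lemma sparse_chi2 (k m n' p : R) : 171 * k ^+ 2 <= n' * p -> m ^+ 2 <= (2 * k) ^+ 2 ->
  4 / 3 * m ^+ 2 <= 1 / 32 * p * n'.
Proof. by move=> h1; rewrite exprMn => h2; have := sqr_ge0 k; lra. Qed.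

(** 48 * 48 = 4 * 576, and an exponent of 4 gives probability at most 1/5 by [expRN_div_le]. *)
Lemma dense_size (D : R) : 48 * 48 <= D -> 4 <= D / 576.
Proof. lra. Qed.

Lemma half_le (a m : R) : 0 < a -> 2 * a <= m -> a <= m.
Proof. lra. Qed.

Lemma dense_chi2 (k p : R) : 24 * k <= p -> k * (9 / 16) * (4 / 3) <= 1 / 32 * p.
Proof. lra. Qed.

(** 16 * 240 = 15 * 256, which makes each of the three Chernoff bounds at most 1/16. *)
Lemma sparse_size (x : R) : 16 * 240 <= x -> 15 <= x / 128 /\ 15 <= x / 256.
Proof. by move=> h; split; lra. Qed.

Lemma complement_mass (x c w : R) : x + (c + (1 - w)) = 1 -> x = w - c.
Proof. lra. Qed.

Lemma quarter_lt (k D : R) : 0 < D -> D <= k -> D < k * 4.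
Proof. lra. Qed.

Lemma three_sixteenths : 1 / 16 + (1 / 16 + 1 / 16) < 1 / 4 :> R.
Proof. lra. Qed.

(** The mean k + 3 D / 4 under the alternative is at least D / 4 away from both ends of
    [k + j, k + D]; with D fewer nonzero entries on average it drops D / 4 below k. *)
Lemma sparse_mean (k D n' j : R) (m := k + 3 / 4 * D) :
  0 < D -> D <= k -> 8 * k <= 3 * n' -> 2 * j <= D ->
  [/\ 0 < m, m <= k + D - D / 4, - m <= - (k + j) - D / 4, m <= 3 / 4 * n' &
      m <= 2 * k /\ m - D = k - D / 4].
Proof. by rewrite /m => *; split; [lra|lra|lra|lra|split; lra]. Qed.

(* Up to constants, M is the largest scale at which the first 2K + 1 moments
   determine the chi-square divergence, and sep is the largest distance from 0
   to the other atoms for which 0 keeps the mass expR (- lam). *)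
Let M (K : nat) := s * Num.sqrt (K%:R / 32).
Let sep (K : nat) (lam : R) := s * Num.sqrt (K%:R / 32) * lam / (4 * K%:R).

Let M_gt0 K : (0 < K)%N -> 0 < M K.
Proof. by move=> K0; rewrite mulr_gt0// sqrtr_gt0 divr_gt0// ltr0n. Qed.

Let M_sqr K : 32 * M K ^+ 2 = s ^+ 2 * K%:R.
Proof. by rewrite exprMn sqr_sqrtr ?divr_ge0//; field. Qed.

Let sep_gt0 K lam : (0 < K)%N -> 0 < lam -> 0 < sep K lam.
Proof.
move=> K0 l0; apply: divr_gt0; last by rewrite mulr_gt0// ltr0n.
by apply: mulr_gt0 => //; exact: M_gt0.
Qed.

Let sep_le K lam : (0 < K)%N -> lam <= 2 * K%:R -> 2 * sep K lam <= M K.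
Proof.
move=> K0 lK; have K0' : (0 : R) < K%:R by rewrite ltr0n.
have M0 := M_gt0 K0.
have -> : 2 * sep K lam = M K * (lam / (2 * K%:R)).
  by rewrite /sep -/(M K); field; rewrite gt_eqF.
by rewrite ler_piMr ?(ltW M0)// ler_pdivrMr ?mulr_gt0// mul1r.
Qed.

Let sep_mass K lam : (0 < K)%N -> 0 < lam -> lam <= 2 * K%:R ->
  mm_mass K (sep K lam) (M K) <= expR lam.
Proof.
move=> K0 l0 lK; have M0 := M_gt0 K0.
have K0' : (0 : R) < K%:R by rewrite ltr0n.
apply: le_trans (mm_mass_le K0 (sep_gt0 K0 l0) (sep_le K0 lK)) _.
rewrite ler_expR (_ : _ / _ = lam)// /sep -/(M K); field.
by rewrite !gt_eqF.
Qed.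

(** The common atom b = M is nonzero, so the alternative has no zero among its k0 + D entries and
    the full D counts in the distance. [lam] is chosen so that (k0 + D) (3/4) exp(- lam), a lower
    bound on the mean number of zeros under the null, is 9/8 D. *)
Lemma hard_dense (k0 D K : nat) (lam : R) :
  (D <= k0)%N -> (k0 + D <= n)%N -> 48 * 48 <= D%:R :> R -> (0 < K)%N ->
  24 * (k0 + D)%:R <= 16 ^+ K :> R ->
  lam = ln (2 / 3 * (k0 + D)%:R / D%:R) -> lam <= 2 * K%:R ->
  hard s n k0 D (sep K lam * Num.sqrt D%:R).
Proof.
move=> Dk kDn DR K0 hK lamE lamK.
have Dr : (0 : R) < D%:R by apply: (lt_le_trans _ DR); rewrite mulr_gt0.
have D0 : (0 < D)%N by rewrite ltr0n in Dr.
have kD : (D%:R : R) <= k0%:R by rewrite ler_nat.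
have ratio : 1 < 2 / 3 * (k0 + D)%:R / D%:R :> R.
  by rewrite ltr_pdivlMr// mul1r natrD; lra.
have lam0 : 0 < lam by rewrite lamE ln_gt0.
have elam : expR lam = 2 / 3 * (k0 + D)%:R / D%:R.
  by rewrite lamE lnK// posrE; apply: lt_trans ratio.
have M0 := M_gt0 K0; have a0 := sep_gt0 K0 lam0; have aM := sep_le K0 lamK.
have Z := sep_mass K0 lam0 lamK.
have Z0 : 0 < mm_mass K (sep K lam) (M K) by apply: mm_mass_gt0.
have w0 : (0 : R) <= 3 / 4 by rewrite divr_ge0.
have w1 : (3 / 4 : R) <= 1 by rewrite ler_pdivrMr// mul1r ler_nat.
have MM : `|M K| <= M K by rewrite ger0_norm// ltW.
have aM1 : M K != 0 -> sep K lam <= `|M K|.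
  by move=> _; rewrite ger0_norm ?(ltW M0)//; exact: half_le a0 aM.
apply: (@hard_moment (k0 + D) k0 D D K (sep K lam) (M K) (3 / 4) (M K)) => //.
- by rewrite M_sqr.
- have h16 : (0 : R) < 16 ^+ K by rewrite exprn_gt0.
  rewrite [(1 / 16) ^+ K]expr_div_n expr1n mul1r ler_pdivrMr//.
  have -> : (3 / 4 : R) ^+ 2 = 9 / 16 by field.
  exact: dense_chi2.
set P := fun c : mm_index K => mm_value (sep K lam) (M K) (M K) c != 0%R.
set p0 := mm_prior0 (sep K lam) (M K) (3 / 4).
set p1 := mm_prior1 (sep K lam) (M K) (3 / 4).
have p0_ge0 c : 0 <= p0 c by exact: mm_prior0_ge0.
have p0_sum : \sum_c p0 c = 1 by exact: mm_prior0_sum.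
have cnt (f : {ffun 'I_n -> mm_index K}) :
    (iid_count (k0 + D) P f + iid_count (k0 + D) (predC P) f = k0 + D)%N.
  rewrite -[RHS](card_ord_lt kDn) -(cardID [pred i | P (f i)]) /iid_count.
  by congr (_ + _)%N; apply: eq_card => i; rewrite !inE// andbC.
have bad1 : \sum_(f : {ffun 'I_n -> mm_index K} |
    ~~ (k0 + D <= iid_count (k0 + D) P f <= k0 + D)%N) iid_prior p1 f = 0.
  apply: big1 => f h; have : (iid_count (k0 + D) (predC P) f != 0)%N.
    by apply: contra h => /eqP h; have := cnt f; rewrite h addn0 => ->; rewrite leqnn.
  rewrite -lt0n => /card_gt0P[i]; rewrite !inE => /andP[_].
  rewrite /P negbK => /eqP vi; rewrite /iid_prior (bigD1 i)//= /p1.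
  case: (f i) vi => [[]|[r e]] /= vi; rewrite ?mul0r//.
    by move: M0; rewrite vi ltxx.
  have : mm_value (sep K lam) (M K) (M K) (inr (r, e)) != 0.
    exact: mm_node_value_neq0.
  by rewrite /= vi eqxx.
have bad0 : \sum_(f : {ffun 'I_n -> mm_index K} |
    ~~ (iid_count (k0 + D) P f <= k0)%N) iid_prior p0 f <= 1 / 5.
  apply: (@le_trans _ _ (\sum_(f : {ffun 'I_n -> mm_index K} |
      - (1 / 36) * D%:R <= - (1 / 36) * (iid_count (k0 + D) (predC P) f)%:R)
      iid_prior p0 f)).
    apply: ler_sum_subpred => [f|f h]; first exact: iid_prior_ge0.
    rewrite ler_nM2l; last by rewrite oppr_lt0 divr_gt0.
    rewrite ler_nat -(leq_add2l (iid_count (k0 + D) P f)) cnt leq_add2r.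
    by rewrite ltnW// ltnNge.
  apply: le_trans (iid_chernoff kDn _ _ _ p0_ge0 p0_sum) _.
  have -> : \sum_(c | predC P c) p0 c = 3 / 4 / mm_mass K (sep K lam) (M K).
    rewrite (eq_bigl (fun c => mm_value (sep K lam) (M K) (M K) c == 0)).
      by rewrite mm_zero0// (negPf (_ : M K != 0)) ?addr0// gt_eqF.
    by move=> c; rewrite /= /P negbK.
  have q : 9 / 8 * D%:R <= (k0 + D)%:R * (3 / 4 / mm_mass K (sep K lam) (M K)) :> R.
    rewrite !mulrA ler_pdivlMr//.
    apply: (@le_trans _ _ (9 / 8 * D%:R * (2 / 3 * (k0 + D)%:R / D%:R))).
      by rewrite ler_wpM2l ?mulr_ge0// -elam.
    by rewrite le_eqVlt; apply/orP; left; apply/eqP; field; rewrite gt_eqF.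
  apply: (@le_trans _ _ (expR (- (D%:R / 576)))).
    by rewrite ler_expR; exact: dense_exponent (ltW Dr) q.
  by apply: (@expRN_div_le _ 4); exact: dense_size.
rewrite bad1 addr0; apply: le_lt_trans bad0 _; exact: ltr_inv_nat.
Qed.

(** The common atom is b = 0 and all n coordinates are random. With m the mean sparsity under the
    alternative, exp(lam) = m / D, so the null mean is at most m - D. Fluctuations leave only j <= D
    / 2 guaranteed extra entries. *)
Lemma hard_sparse (k0 D K j : nat) (lam : R) :
  (0 < D <= k0)%N -> (8 * k0 <= 3 * n)%N -> 16 * 240 * k0%:R <= D%:R ^+ 2 :> R -> (0 < K)%N ->
  171 * k0%:R ^+ 2 <= n%:R * 16 ^+ K :> R ->
  lam = ln (3 / 4 + k0%:R / D%:R) -> lam <= 2 * K%:R -> 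
  (0 < j)%N -> (2 * j <= D)%N ->
  hard s n k0 D (sep K lam * Num.sqrt j%:R).
Proof.
move=> /andP[D0 Dk] kn Dk2 K0 hK lamE lamK j0 jD.
have Dr : (0 : R) < D%:R by rewrite ltr0n.
have kD : (D%:R : R) <= k0%:R by rewrite ler_nat.
have kr : (0 : R) < k0%:R by exact: lt_le_trans kD.
have n0 : (0 < n)%N by clear -D0 Dk kn; lia.
have nr : (0 : R) < n%:R by rewrite ltr0n.
have knr : 8 * k0%:R <= 3 * n%:R :> R by rewrite -!natrM ler_nat.
have jDr : 2 * j%:R <= D%:R :> R by rewrite -natrM ler_nat.
pose m := k0%:R + 3 / 4 * D%:R : R.
have [m0 m_hi m_lo wm [m_le m_D]] := sparse_mean Dr kD knr jDr.
rewrite -/m in m0 m_hi m_lo wm m_le m_D.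
have m_ratio : 3 / 4 + k0%:R / D%:R = m / D%:R by rewrite /m; field; rewrite gt_eqF.
have ratio : 1 < 3 / 4 + k0%:R / D%:R :> R.
  rewrite m_ratio ltr_pdivlMr// mul1r -subr_gt0 m_D subr_gt0 ltr_pdivrMr//.
  exact: quarter_lt.
have lam0 : 0 < lam by rewrite lamE ln_gt0.
have elam : expR lam = 3 / 4 + k0%:R / D%:R.
  by rewrite lamE lnK// posrE; apply: lt_trans ratio.
have M0 := M_gt0 K0; have a0 := sep_gt0 K0 lam0; have aM := sep_le K0 lamK.
have Z := sep_mass K0 lam0 lamK.
have Z0 : 0 < mm_mass K (sep K lam) (M K) by apply: mm_mass_gt0.
have mE : m = k0%:R + 3 / 4 * D%:R by [].
clearbody m.
pose w : R := m / n%:R.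
have nw : n%:R * w = m by rewrite /w mulrC divfK// gt_eqF.
have w0 : 0 <= w by rewrite divr_ge0// ltW.
have w34 : w <= 3 / 4 by rewrite ler_pdivrMr.
have w1 : w <= 1.
  by apply: le_trans w34 _; rewrite ler_pdivrMr// mul1r ler_nat.
apply: (@hard_moment n k0 D j K (sep K lam) (M K) w 0) => //.
- by rewrite normr0 ltW.
- by rewrite eqxx.
- by rewrite M_sqr.
- have h16 : (0 : R) < 16 ^+ K by rewrite exprn_gt0.
  rewrite [(1 / 16) ^+ K]expr_div_n expr1n mul1r ler_pdivrMr//.
  have -> : n%:R * w ^+ 2 * (4 / 3) = 4 / 3 * m ^+ 2 / n%:R.
    by rewrite /w; field; rewrite gt_eqF.
  rewrite ler_pdivrMr//.
  have m2 : m ^+ 2 <= (2 * k0%:R) ^+ 2.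
    by apply: lerXn2r; rewrite ?nnegrE ?mulr_ge0// ltW.
  exact: sparse_chi2 hK m2.
set P := fun c : mm_index K => mm_value (sep K lam) (M K) 0 c != 0%R.
set p0 := mm_prior0 (sep K lam) (M K) w.
set p1 := mm_prior1 (sep K lam) (M K) w.
have p0_ge0 c : 0 <= p0 c by exact: mm_prior0_ge0.
have p0_sum : \sum_c p0 c = 1 by exact: mm_prior0_sum.
have p1_ge0 c : 0 <= p1 c by exact: mm_prior1_ge0.
have p1_sum : \sum_c p1 c = 1 by exact: mm_prior1_sum.
have q1 : \sum_(c | P c) p1 c = w by rewrite mm_nonzero1// eqxx/= addr0.
have q0 : n%:R * (\sum_(c | P c) p0 c) <= k0%:R - D%:R / 4.
  have -> : \sum_(c | P c) p0 c = w - w / mm_mass K (sep K lam) (M K).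
    have := p0_sum; rewrite (bigID P)/=.
    rewrite [X in _ + X](eq_bigl (fun c => mm_value (sep K lam) (M K) 0 c == 0)).
      rewrite mm_zero0// eqxx/= => h.
      exact: complement_mass h.
    by move=> c; rewrite /P negbK.
  rewrite mulrBr nw [X in _ - X]mulrA nw.
  have : D%:R <= m / mm_mass K (sep K lam) (M K).
    rewrite ler_pdivlMr//.
    apply: (@le_trans _ _ (D%:R * expR lam)); first by rewrite ler_wpM2l.
    by rewrite elam m_ratio mulrC divfK// gt_eqF.
  by move=> h; rewrite -m_D lerD2l lerN2.
have nq0 : 0 <= n%:R * (\sum_(c | P c) p0 c) by rewrite mulr_ge0// sumr_ge0.
have X : 16 * 240 <= D%:R ^+ 2 / k0%:R :> R by rewrite ler_pdivlMr.
have bad0 : \sum_(f : {ffun 'I_n -> mm_index K} |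
    ~~ (iid_count n P f <= k0)%N) iid_prior p0 f <= 1 / 16.
  pose l : R := D%:R / (16 * k0%:R).
  have l0 : 0 < l by rewrite divr_gt0// mulr_gt0.
  apply: (@le_trans _ _ (\sum_(f : {ffun 'I_n -> mm_index K} |
      l * k0%:R <= l * (iid_count n P f)%:R) iid_prior p0 f)).
    apply: ler_sum_subpred => [f|f h]; first exact: iid_prior_ge0.
    by rewrite ler_pM2l// ler_nat ltnW// ltnNge.
  apply: le_trans (iid_chernoff (leqnn n) _ _ _ p0_ge0 p0_sum) _.
  apply: le_trans (@expRN_div_le (D%:R ^+ 2 / k0%:R / 128) 15 _); last first.
    exact: (sparse_size X).1.
  by rewrite ler_expR; exact: sparse_exponent_null.
pose l : R := D%:R / (32 * k0%:R).
have l0 : 0 < l by rewrite divr_gt0// mulr_gt0.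
have cher1 (x y : R) (S : pred {ffun 'I_n -> mm_index K}) : x = 1 \/ x = -1 ->
    (forall f, S f -> x * y <= x * (iid_count n P f)%:R) ->
    x * m <= x * y - D%:R / 4 ->
    \sum_(f | S f) iid_prior p1 f <= 1 / 16.
  move=> x1 hS xy; apply: (@le_trans _ _ (\sum_(f : {ffun 'I_n -> mm_index K} |
      x * l * y <= x * l * (iid_count n P f)%:R) iid_prior p1 f)).
    apply: ler_sum_subpred => [f|f /hS h]; first exact: iid_prior_ge0.
    by rewrite -!(mulrC l) -!(mulrA l) ler_pM2l.
  apply: le_trans (iid_chernoff (leqnn n) _ _ _ p1_ge0 p1_sum) _.
  rewrite q1 nw.
  apply: le_trans (@expRN_div_le (D%:R ^+ 2 / k0%:R / 256) 15 _); last first.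
    exact: (sparse_size X).2.
  by rewrite ler_expR mE; apply: sparse_exponent_alt; rewrite -?mE.
have bad_hi : \sum_(f : {ffun 'I_n -> mm_index K} |
    ~~ (iid_count n P f <= k0 + D)%N) iid_prior p1 f <= 1 / 16.
  apply: (cher1 1 (k0 + D)%:R); first by left.
    by move=> f h; rewrite !mul1r ler_nat ltnW// ltnNge.
  by rewrite !mul1r natrD; exact: m_hi.
have bad_lo : \sum_(f : {ffun 'I_n -> mm_index K} |
    ~~ (k0 + j <= iid_count n P f)%N) iid_prior p1 f <= 1 / 16.
  apply: (cher1 (- 1) (k0 + j)%:R); first by right.
    by move=> f h; rewrite !mulN1r lerN2 ler_nat ltnW// ltnNge.
  by rewrite !mulN1r natrD; exact: m_lo.
have sixteenth : 1 / 16 + (1 / 16 + 1 / 16) < 1 / 4 :> R by exact: three_sixteenths.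
apply: le_lt_trans sixteenth; apply: lerD => //.
under eq_bigl do rewrite negb_and.
apply: (le_trans (ler_sum_predU _ _ _)); first by move=> f; exact: iid_prior_ge0.
exact: lerD.
Qed.

End MomentLowerBounds.

(** * Comparison of the logarithms in the different regimes *)

Section RateComparisons.
Context (R : realType).
Implicit Types (x y t u l S : R).

Lemma bernoulli_le u (m : nat) : 0 <= u -> 1 + m%:R * u <= (1 + u) ^+ m.
Proof.
move=> u0; elim: m => [|m IH]; first by rewrite mul0r addr0 expr0.
rewrite exprSr -natr1; apply: (@le_trans _ _ ((1 + m%:R * u) * (1 + u))).
  have : 0 <= m%:R * u * u by rewrite mulr_ge0// mulr_ge0.
  lra.
by rewrite ler_wpM2r// addr_ge0.
Qed.

Lemma ln_le_mul (m : nat) x y : 0 < x -> 0 < y -> x <= y ^+ m -> ln x <= m%:R * ln y.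
Proof.
move=> x0 y0 h; rewrite mulr_natl -lnXn// ler_ln ?posrE//.
exact: exprn_gt0.
Qed.

Lemma exists_log x : 4 <= x ->
  exists K : nat, [/\ (0 < K)%N, x <= expR K%:R, K%:R <= 2 * ln x & ln x <= K%:R].
Proof.
move=> x4; have x0 : 0 < x by lra.
have l1 : 1 <= ln x.
  rewrite -[leLHS]expRK ler_ln ?posrE ?expR_gt0//.
  by apply: le_trans x4; exact: expR1_le4.
exists (Num.truncn (ln x)).+1.
have h1 := truncnS_gt (ln x).
have h2 : (Num.truncn (ln x))%:R <= ln x by rewrite truncn_le//; lra.
split=> //; last exact: ltW.
- by rewrite -[leLHS]lnK ?posrE// ler_expR ltW.
- by rewrite -natr1; lra.
Qed.

Lemma expR_nat_le (K : nat) : expR K%:R <= 16 ^+ K :> R.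
Proof.
rewrite -[X in expR X]mulr1 expRM_natl lerXn2r ?nnegrE ?expR_ge0//.
by apply: le_trans (expR1_le4 R) _; lra.
Qed.


(** Bernoulli's inequality with exponent 32 D, as 32 D u = k / D. *)
Lemma ln_few (k : R) (D : nat) : 0 <= k -> (0 < D)%N -> D%:R <= 48 * 48 :> R ->
  ln (1 + k / D%:R) <= 32 * (48 * 48) * ln (1 + k / (32 * D%:R ^+ 2)).
Proof.
move=> k0 D0 Dle; have Dr : (0 : R) < D%:R by rewrite ltr0n.
set u := k / (32 * _).
have u0 : 0 <= u by rewrite divr_ge0// mulr_ge0// exprn_ge0.
have l0 : 0 <= ln (1 + u) by rewrite ln_ge0// lerDl.
apply: (@le_trans _ _ ((32 * D)%:R * ln (1 + u))).
  apply: ln_le_mul; rewrite ?ltr_wpDr ?divr_ge0 ?(ltW Dr)//.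
  apply: le_trans (bernoulli_le _ u0).
  rewrite natrM le_eqVlt; apply/orP; left; apply/eqP; congr (_ + _).
  by rewrite /u; field; rewrite gt_eqF.
by rewrite natrM ler_wpM2r// ler_wpM2l.
Qed.

(** The assumption bounds k / D by a multiple of (q / D)^3, and a cube costs only a factor 3 in the
    logarithm; 16^3 exceeds 16 * 240. *)
Lemma ln_signed (k D q : R) : 0 <= k -> 0 < D -> 0 <= q ->
  k * D ^+ 2 <= 16 * 240 * q ^+ 3 ->
  ln (1 + k / D) <= 3 * (128 * ln (1 + q / (8 * D))).
Proof.
move=> k0 D0 q0 h.
pose t := q / D; have t0 : 0 <= t by rewrite divr_ge0// ltW.
have -> : q / (8 * D) = t / 8 by rewrite /t; field; rewrite gt_eqF.
have xt : k / D <= 16 * 240 * t ^+ 3.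
  rewrite ler_pdivrMr// (_ : 16 * 240 * t ^+ 3 * D = 16 * 240 * q ^+ 3 / D ^+ 2).
    by rewrite ler_pdivlMr// exprn_gt0.
  by rewrite /t; field; rewrite gt_eqF.
have t8 : 0 <= t / 8 by rewrite divr_ge0.
have b : 1 + 16 * t <= (1 + t / 8) ^+ 128.
  by apply: le_trans (bernoulli_le 128 t8); lra.
have p : 0 < 1 + t / 8 by rewrite ltr_wpDr.
have p16 : 0 < 1 + 16 * t by rewrite ltr_wpDr// mulr_ge0.
apply: (@le_trans _ _ (3 * ln (1 + 16 * t))).
  apply: ln_le_mul => //; first by rewrite ltr_wpDr// divr_ge0// ltW.
  have t3 : 0 <= t ^+ 3 by exact: exprn_ge0.
  have t2 : 0 <= t ^+ 2 by exact: exprn_ge0.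
  have -> : (1 + 16 * t) ^+ 3 =
      1 + 16 * 240 * t ^+ 3 + (48 * t + 768 * t ^+ 2 + 256 * t ^+ 3) by ring.
  rewrite -[leLHS]addr0; apply: lerD; first by rewrite lerD2l.
  apply: addr_ge0; last exact: mulr_ge0 (ler0n _ _) t3.
  by apply: addr_ge0; [exact: mulr_ge0 (ler0n _ _) t0|exact: mulr_ge0 (ler0n _ _) t2].
by rewrite ler_pM2l//; exact: ln_le_mul.
Qed.

Lemma ln_dense (k D : R) : 0 < D -> D <= k ->
  ln (1 + k / D) <= 3 * ln (2 / 3 * (k + D) / D).
Proof.
move=> D0 Dk; set x := k / D.
have x1 : 1 <= x by rewrite /x ler_pdivlMr// mul1r.
have -> : 2 / 3 * (k + D) / D = 2 / 3 * (1 + x) by rewrite /x; field; rewrite gt_eqF.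
apply: ln_le_mul; [lra|lra|].
have h : 0 <= (1 + x) * ((x - 1) * (x + 3)) by rewrite !mulr_ge0//; lra.
have h2 : 0 <= (x - 1) by lra.
rewrite -subr_ge0 (_ : _ - _ = 8 / 27 * ((1 + x) * ((x - 1) * (x + 3))) + 5 / 27 * (1 + x)).
  lra.
by field.
Qed.

Lemma ln_sparse x : 1 <= x -> ln (1 + x) <= 2 * ln (3 / 4 + x).
Proof.
move=> x1; apply: ln_le_mul; [lra|lra|].
have : 0 <= x * (x - 1) by rewrite mulr_ge0//; lra.
lra.
Qed.

(** With y = k / q, the assumption q^3 <= k^2 amounts to k <= y^3; and 48 <= 2^6. *)
Lemma ln_dense_degree (k q : R) : 0 < q -> q < k -> q ^+ 3 <= k ^+ 2 ->
  ln (48 * k) <= 9 * ln (1 + k / q).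
Proof.
move=> q0 qk h; set y := k / q.
have k0 : 0 < k by exact: lt_trans qk.
have y1 : 1 <= y by rewrite /y ler_pdivlMr// mul1r ltW.
apply: ln_le_mul; [by rewrite mulr_gt0|lra|].
rewrite (_ : 9%N = (6 + 3)%N)// exprD.
apply: ler_pM; [lra|exact: ltW| |].
  apply: (@le_trans _ _ (2 ^+ 6)); first lra.
  by rewrite lerXn2r ?nnegrE//; lra.
apply: (@le_trans _ _ (y ^+ 3)); last by rewrite lerXn2r ?nnegrE//; lra.
rewrite /y expr_div_n ler_pdivlMr ?exprn_gt0// [leRHS]exprS ler_pM2l//.
Qed.

Lemma ln_sparse_degree y : 1 <= y -> ln (171 * y ^+ 2) <= 10 * ln (1 + y).
Proof.
move=> y1; apply: ln_le_mul; [by rewrite mulr_gt0// exprn_gt0//; lra|lra|].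
rewrite (_ : 10%N = (8 + 2)%N)// exprD.
apply: ler_pM; [lra|exact: sqr_ge0| |].
  apply: (@le_trans _ _ (2 ^+ 8)); first lra.
  by rewrite lerXn2r ?nnegrE//; lra.
by rewrite lerXn2r ?nnegrE//; lra.
Qed.

Lemma moment_ratio (K lam L S D j C m p c : R) :
  0 < S -> 0 < K -> 0 <= L -> L <= m * lam -> K <= C * S -> 0 <= D -> D <= p * j ->
  p * m ^+ 2 * C <= c -> 0 <= j ->
  D * (L ^+ 2 / S) <= c * (lam ^+ 2 * j / K).
Proof.
move=> S0 K0 L0 Lm KC D0 Dp pmC j0.
rewrite mulrA [leRHS]mulrA ler_pdivrMr// mulrAC ler_pdivlMr//.
have L2 : L ^+ 2 <= (m * lam) ^+ 2.
  by apply: lerXn2r => //; rewrite nnegrE (le_trans L0).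
apply: (@le_trans _ _ (p * j * (m * lam) ^+ 2 * (C * S))).
  apply: ler_pM => //; [by rewrite mulr_ge0 ?sqr_ge0|exact: ltW|].
  by apply: ler_pM => //; exact: sqr_ge0.
rewrite (_ : _ * (C * S) = p * m ^+ 2 * C * (lam ^+ 2 * j * S)); last by ring.
rewrite -[leRHS]mulrA; apply: ler_wpM2r => //.
by rewrite mulr_ge0 ?(ltW S0)// mulr_ge0 ?sqr_ge0.
Qed.

Lemma scaled_rate (e c s2 X Y : R) : 0 < e -> 0 < c -> 0 <= s2 -> Y <= c * X ->
  1 / (e * c) * s2 * Y <= s2 * (X / e).
Proof.
move=> e0 c0 s0 YX; rewrite mul1r -mulrA mulrCA; apply: ler_wpM2l => //.
rewrite mulrC ler_pdivrMr ?mulr_gt0//.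
by rewrite (_ : X / e * (e * c) = c * X)//; field; rewrite gt_eqF.
Qed.

(** The squared separation is s^2 lam^2 j / (512 K), whence 512; and 240 = 3 * 2^2 * 20 is the value
    of p m^2 C in the sparse regime, the larger of the two. *)
Lemma moment_rate (s K lam L S D j C m p : R) :
  0 < S -> 0 < K -> 0 <= L -> L <= m * lam -> K <= C * S -> 0 <= D -> D <= p * j ->
  p * m ^+ 2 * C <= 240 -> 0 <= j ->
  1 / (512 * 240) * s ^+ 2 * (D * (L ^+ 2 / S)) <=
  (s * Num.sqrt (K / 32) * lam / (4 * K) * Num.sqrt j) ^+ 2.
Proof.
move=> S0 K0 L0 Lm KC D0 Dp pmC j0.
have -> : (s * Num.sqrt (K / 32) * lam / (4 * K) * Num.sqrt j) ^+ 2 =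
    s ^+ 2 * (lam ^+ 2 * j / K / 512).
  rewrite exprMn sqr_sqrtr// expr_div_n !exprMn sqr_sqrtr; last by rewrite divr_ge0// ltW.
  by field; rewrite gt_eqF.
apply: scaled_rate; rewrite ?ltr0n ?sqr_ge0//.
exact: moment_ratio Lm KC _ Dp pmC _.
Qed.

Lemma min_rate (L S : R) : Num.min (L ^+ 2 / S) L <= L ^+ 2 / S /\ Num.min (L ^+ 2 / S) L <= L.
Proof. by split; rewrite ge_min lexx ?orbT. Qed.

Lemma sub_min_rate (c s2 rho2 D B L S : R) :
  0 <= c -> 0 <= s2 -> 0 <= D -> (B = L ^+ 2 / S \/ B = L) ->
  c * s2 * (D * B) <= rho2 ->
  c * s2 * (D * Num.min (L ^+ 2 / S) L) <= rho2.
Proof.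
move=> c0 s0 D0 hB; apply: le_trans.
have [h1 h2] := min_rate L S.
by apply: ler_wpM2l; [exact: mulr_ge0|apply: ler_wpM2l => //; case: hB => ->].
Qed.

(** [q] stands for sqrt n. The third item makes D exceed the fluctuations of the sparsity; the
    fourth, which amounts to q^2 <= k D, keeps [lam] within reach of the degree K. *)
Lemma sparse_cases (k q D : R) : 1 <= q -> q < k -> k ^+ 2 < q ^+ 3 -> 48 * 48 <= q ^+ 2 ->
  0 < D ->
  [/\ 8 * k <= 3 * q ^+ 2, 4 * k < q ^+ 2, 
   16 * 240 * q ^+ 3 < k * D ^+ 2 -> 16 * 240 * k <= D ^+ 2 &
   16 * 240 * q ^+ 3 < k * D ^+ 2 -> k / D <= (k / q) ^+ 2].
Proof.
move=> q1 qk kq2 qbig D0.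
have q0 : 0 < q by exact: lt_le_trans q1.
have k0 : 0 < k by exact: lt_trans qk.
have k4 : 4 * k < q ^+ 2.
  rewrite -(@ltr_pXn2r _ 2)// ?nnegrE ?mulr_ge0 ?exprn_ge0 ?(ltW k0) ?(ltW q0)//.
  rewrite exprMn -exprM (_ : (2 * 2)%N = (3 + 1)%N)// exprD expr1.
  have q16 : 16 <= q.
    rewrite -(@ler_pXn2r _ 2)// ?nnegrE ?(ltW q0)//; lra.
  have h1 : 4 ^+ 2 * k ^+ 2 < 4 ^+ 2 * q ^+ 3 by rewrite ltr_pM2l// exprn_gt0.
  have h2 : 4 ^+ 2 * q ^+ 3 <= q ^+ 3 * q.
    rewrite mulrC ler_pM2l ?exprn_gt0//; lra.
  exact: lt_le_trans h1 h2.
split => //.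
- lra.
- move=> h; have : 16 * 240 * k ^+ 2 < k * D ^+ 2.
    by apply: lt_trans h; rewrite ltr_pM2l.
  by rewrite expr2 mulrCA ltr_pM2l// => /ltW.
- move=> h; rewrite -(@ler_pXn2r _ 2)//; last 2 first.
  + by rewrite nnegrE divr_ge0// ltW.
  + by rewrite nnegrE exprn_ge0// divr_ge0// ltW.
  have main : k ^+ 2 * q ^+ 4 <= k ^+ 4 * D ^+ 2.
    rewrite (_ : k ^+ 2 * q ^+ 4 = k ^+ 2 * q * q ^+ 3); last by ring.
    rewrite (_ : k ^+ 4 * D ^+ 2 = k ^+ 2 * k * (k * D ^+ 2)); last by ring.
    apply: ler_pM; [by rewrite mulr_ge0 ?sqr_ge0 ?(ltW q0)|by rewrite exprn_ge0 ?(ltW q0)| |].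
      by apply: ler_wpM2l; [exact: sqr_ge0|exact: ltW].
    apply: le_trans (ltW h); rewrite -[leLHS]mul1r; apply: ler_wpM2r.
      by rewrite exprn_ge0 ?(ltW q0).
    by rewrite -natrM ler1n.
  rewrite -exprM !expr_div_n ler_pdivrMr ?exprn_gt0//.
  rewrite mulrAC ler_pdivlMr ?exprn_gt0//; exact: main.
Qed.

Lemma half_sum (k D : R) : D <= k -> 24 * (k + D) <= 48 * k.
Proof. lra. Qed.

Lemma dense_ratio (k D : nat) : (0 < D)%N ->
  2 / 3 * (k + D)%:R / D%:R <= 24 * (k + D)%:R :> R.
Proof.
move=> D0; rewrite ler_pdivrMr ?ltr0n// -!mulrA mulrC -!mulrA mulrC.
have h : 0 <= (k + D)%:R :> R by rewrite ler0n.
have h2 : 1 <= D%:R :> R by rewrite ler1n.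
have h3 := ler_wpM2l h h2.
lra.
Qed.

Lemma twice_le (x y a b : R) : b = 2 * a -> x <= a * y -> 2 * x <= b * y.
Proof. by move=> ->; lra. Qed.

Lemma ge4_sqr y : 1 <= y -> 4 <= 171 * y ^+ 2.
Proof.
move=> y1; have : 1 <= y ^+ 2 by exact: exprn_ege1.
lra.
Qed.

Lemma sparse_ratio x y : 1 <= x -> 1 <= y -> x <= y ^+ 2 ->
  1 <= 3 / 4 + x /\ 3 / 4 + x <= 171 * y ^+ 2.
Proof. by move=> x1 y1 xy; split; lra. Qed.

Lemma linear_rate (c s2 D L l : R) : 0 <= s2 -> 0 <= D -> c * L <= l ->
  c * s2 * (D * L) <= s2 * l * D.
Proof.
move=> s0 D0 h; rewrite (_ : c * s2 * (D * L) = s2 * (c * L) * D); last by ring.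
by apply: ler_wpM2r => //; exact: ler_wpM2l.
Qed.

Lemma few_constant (L l : R) : 0 <= l -> L <= 32 * (48 * 48) * l ->
  1 / (512 * 240) * L <= l.
Proof. move=> l0 h; lra. Qed.

Lemma signed_constant (L l : R) : 0 <= l -> L <= 3 * (128 * l) ->
  1 / (512 * 240) * L <= l.
Proof. move=> l0 h; lra. Qed.

End RateComparisons.

Section SparsityLowerBound.
Context (R : realType) (s : R) (n : nat).
Let q : R := Num.sqrt n%:R.
Let c : R := 1 / (512 * 240).

Let c_ge0 : 0 <= c. Proof. by rewrite /c mul1r invr_ge0 mulr_ge0 ?ler0n. Qed.

Let q_sqr : q ^+ 2 = n%:R. Proof. by rewrite sqr_sqrtr ?ler0n. Qed.

(** For k0 = 1 the bounds on D force n >= 2; from k0 = 2 on, 2 k0 <= k0^2 <= n. *)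
Lemma small_k0 (k0 D : nat) : k0%:R <= q -> (0 < D)%N -> (D <= n - k0)%N ->
  (n <= 2 * (n - k0))%N.
Proof.
move=> kq D0 Dn.
have k2 : (k0 * k0 <= n)%N.
  rewrite -(ler_nat R) natrM -q_sqr expr2.
  by apply: ler_pM; rewrite ?ler0n.
case: k0 k2 Dn {kq} => [|[|k]]; [lia|lia|].
by rewrite !mulSn; lia.
Qed.

Hypothesis s_gt0 : 0 < s.

Lemma hard_rate_min (k0 D : nat) : q < k0%:R -> (0 < D)%N ->
  (D <= minn k0 (n - k0))%N ->
  exists2 rho, hard s n k0 D rho &
    c * s ^+ 2 * (D%:R * Num.min
      (ln (1 + k0%:R / D%:R) ^+ 2 / ln (1 + k0%:R / q)) (ln (1 + k0%:R / D%:R)))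
    <= rho ^+ 2.
Proof.
move=> qk D0; rewrite leq_min => /andP[Dk Dn].
have kDn : (k0 + D <= n)%N by lia.
have n0 : (0 < n)%N by lia.
have kn : (k0 <= n)%N by lia.
have k0p : (0 < k0)%N by lia.
have Dn' : (D <= n)%N by lia.
have q1 : 1 <= q by rewrite /q -[leLHS]sqrtr1 ler_wsqrtr// ler1n.
have q0 : 0 < q by exact: lt_le_trans q1.
have Dr : (0 : R) < D%:R by rewrite ltr0n.
have kr : (0 : R) < k0%:R by rewrite ltr0n.
have Dkr : (D%:R : R) <= k0%:R by rewrite ler_nat.
set L := ln (1 + k0%:R / D%:R); set S := ln (1 + k0%:R / q).
have s2 : 0 <= s ^+ 2 by exact: sqr_ge0.
have L0 : 0 <= L by rewrite ln_ge0// lerDl divr_ge0// ltW.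
have S0 : 0 < S by rewrite ln_gt0// ltrDl divr_gt0.
have sqr_rho (l : R) : 0 <= l ->
    (s * Num.sqrt l * Num.sqrt D%:R) ^+ 2 = s ^+ 2 * l * D%:R.
  by move=> l0; rewrite !exprMn !sqr_sqrtr// ler0n.
(* Below this size the Chernoff bound of [hard_dense] is too weak; the block design does without
   concentration. *)
have [Dsmall|Dbig] := lerP (D%:R : R) (48 * 48).
  pose l := ln (1 + k0%:R / (32 * D%:R ^+ 2)) : R.
  have l0 : 0 <= l.
    by rewrite ln_ge0// lerDl divr_ge0 ?ler0n// mulr_ge0 ?ler0n ?sqr_ge0.
  exists (s * Num.sqrt l * Num.sqrt D%:R); first exact: hard_blocks_removed.
  rewrite sqr_rho//; apply: (sub_min_rate (B := L)) => //; first by right.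
  apply: linear_rate => //; apply: few_constant => //.
  exact: ln_few (ltW kr) D0 Dsmall.
have Dbig' := ltW Dbig.
have [kq|kq] := lerP (q ^+ 3) (k0%:R ^+ 2).
  have k48 : 4 <= 48 * k0%:R :> R.
    by rewrite -natrM ler_nat; apply: (@leq_trans (48 * 1)) => //; rewrite leq_mul2l.
  have [K [K0 KX K2 Kl]] := exists_log k48.
  pose lam : R := ln (2 / 3 * (k0 + D)%:R / D%:R).
  have Llam : L <= 3 * lam by rewrite /lam natrD; exact: ln_dense.
  have kD2 : 24 * (k0 + D)%:R <= 48 * k0%:R :> R by rewrite natrD; exact: half_sum.
  have K16 : 24 * (k0 + D)%:R <= 16 ^+ K :> R.
    by apply: le_trans kD2 _; apply: le_trans KX (expR_nat_le _ _).
  have lamK : lam <= 2 * K%:R.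
    apply: (@le_trans _ _ K%:R); last by rewrite ler_peMl ?ler0n// ler1n.
    apply: le_trans Kl; rewrite /lam.
    rewrite ler_ln ?posrE ?mulr_gt0 ?invr_gt0 ?ltr0n ?addn_gt0 ?D0 ?orbT//.
    apply: le_trans kD2; exact: dense_ratio.
  exists (s * Num.sqrt (K%:R / 32) * lam / (4 * K%:R) * Num.sqrt D%:R).
    exact: hard_dense.
  apply: (sub_min_rate (B := L ^+ 2 / S)) => //; first by left.
  have KS : K%:R <= 18 * S.
    apply: le_trans K2 _; apply: (twice_le (a := 9)); first by rewrite -natrM.
    exact: ln_dense_degree.
  apply: (@moment_rate R s K%:R lam L S D%:R D%:R 18 3 1) => //.
  - by rewrite ltr0n.
  - by rewrite mul1r.
  - by rewrite mul1r -natrX -natrM ler_nat.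
have nbig : 48 * 48 <= q ^+ 2.
  by rewrite q_sqr; apply: le_trans Dbig' _; rewrite ler_nat.
have [k8 k4 Dk2 xy] := sparse_cases q1 qk kq nbig Dr.
rewrite q_sqr in k8 k4.
have [kD|kD] := lerP (k0%:R * D%:R ^+ 2) (16 * 240 * q ^+ 3).
  pose l := ln (1 + q / (8 * D%:R)) : R.
  have l0 : 0 <= l.
    by rewrite ln_ge0// lerDl divr_ge0 ?(ltW q0)// mulr_ge0 ?ler0n.
  exists (s * Num.sqrt l * Num.sqrt D%:R).
    apply: hard_blocks_signed => //.
    by move: k4; rewrite -natrM ltr_nat; clear; lia.
  rewrite sqr_rho//; apply: (sub_min_rate (B := L)) => //; first by right.
  apply: linear_rate => //; apply: signed_constant => //.
  by apply: ln_signed kD => //; exact: ltW.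
set x := k0%:R / D%:R in L L0 xy *; set y := k0%:R / q in S S0 xy *.
have x1 : 1 <= x by rewrite /x ler_pdivlMr// mul1r.
have y1 : 1 <= y by rewrite /y ler_pdivlMr// mul1r ltW.
have y4 := ge4_sqr y1.
have [K [K0 KX K2 Kl]] := exists_log y4.
pose lam : R := ln (3 / 4 + x).
have Llam : L <= 2 * lam by exact: ln_sparse.
have lamK : lam <= 2 * K%:R.
  apply: (@le_trans _ _ K%:R); last by rewrite ler_peMl ?ler0n// ler1n.
  apply: le_trans Kl; have [h1 h2] := sparse_ratio x1 y1 (xy kD).
  rewrite /lam ler_ln ?posrE//; first exact: lt_le_trans h1.
  by apply: lt_le_trans h2; exact: lt_le_trans h1.
have K16 : 171 * k0%:R ^+ 2 <= n%:R * 16 ^+ K :> R.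
  rewrite -q_sqr mulrC.
  apply: (@le_trans _ _ (q ^+ 2 * (171 * y ^+ 2))).
    rewrite /y expr_div_n le_eqVlt; apply/orP; left; apply/eqP; field.
    by rewrite gt_eqF.
  apply: ler_wpM2l; first exact: sqr_ge0.
  by apply: le_trans KX (expR_nat_le _ _).
have D2 : (1 < D)%N.
  by rewrite -(ltr_nat R); apply: lt_trans Dbig; rewrite -natrM ltr_nat.
(* Halving costs at most a factor 3, since D <= 3 (D %/ 2) once D >= 2. *)
exists (s * Num.sqrt (K%:R / 32) * lam / (4 * K%:R) * Num.sqrt (D %/ 2)%:R).
  apply: hard_sparse => //.
  - by rewrite D0.
  - by move: k8; rewrite -!natrM ler_nat.
  - exact: Dk2 kD.
  - by rewrite divn_gt0.
  - by rewrite mulnC leq_trunc_div.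
apply: (sub_min_rate (B := L ^+ 2 / S)) => //; first by left.
have KS : K%:R <= 20 * S.
  apply: le_trans K2 _; apply: (twice_le (a := 10)); first by rewrite -natrM.
  exact: ln_sparse_degree.
apply: (@moment_rate R s K%:R lam L S D%:R (D %/ 2)%:R 20 2 3) => //.
- by rewrite ltr0n.
- by rewrite -natrM ler_nat; move: D2; clear; lia.
- by rewrite -natrX -!natrM ler_nat.
Qed.

End SparsityLowerBound.

Theorem theorem1 (R : realType) :
  exists2 c : R, 0 < c &
  forall (n : nat) (sigma gamma : R),
    (1 <= n)%N -> 0 < sigma -> gamma <= 2^-1 ->
    (forall k0 D : nat,
       k0%:R <= Num.sqrt (n%:R : R) -> (1 <= D)%N -> (D <= n - k0)%N ->
       ((sigma ^+ 2 * D%:R *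
           ln (1 + Num.sqrt n%:R / (8 * D%:R)))%:E
         <= sep_dist n sigma gamma k0 D ^+ 2)%E)
    /\
    (forall k0 D : nat,
       Num.sqrt (n%:R : R) < k0%:R -> (1 <= D)%N -> (D <= n - k0)%N ->
       ((D <= minn k0 (n - k0))%N ->
         ((c * sigma ^+ 2 *
             (D%:R * Num.min
                (ln (1 + k0%:R / D%:R) ^+ 2 / ln (1 + k0%:R / Num.sqrt n%:R))
                (ln (1 + k0%:R / D%:R))))%:E
           <= sep_dist n sigma gamma k0 D ^+ 2)%E)
       /\
       ((k0 < D)%N ->
         ((c * sigma ^+ 2 *
             (k0%:R / ln (1 + k0%:R / Num.sqrt n%:R)))%:E
           <= sep_dist n sigma gamma k0 D ^+ 2)%E)).
Proof.
have ln2_gt0 : 0 < ln 2 :> R by rewrite ln_gt0// ltr1n.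
have ln2_le1 : ln 2 <= 1 :> R.
  by have := @le_ln1Dx R 1; apply; rewrite (lt_trans (ltrN10 _)).
pose c0 : R := 1 / (512 * 240).
have c0_gt0 : 0 < c0 by rewrite /c0 mul1r invr_gt0 mulr_gt0 ?ltr0n.
(* [ln 2 ^+ 2] is the squared log(1 + k0 / D) at D = k0, to which k0 < D is reduced; it only weakens
   the other case, as ln 2 <= 1. *)
exists (c0 * ln 2 ^+ 2); first by rewrite mulr_gt0// exprn_gt0.
move=> n s gamma n0 s0 g2; split=> [k0 D kq D0 Dn|k0 D qk D0 Dn].
  set l := ln _.
  have l0 : 0 <= l.
    by rewrite ln_ge0// lerDl divr_ge0 ?sqrtr_ge0// mulr_ge0 ?ler0n.
  have H := hard_blocks_signed s0 D0 Dn (small_k0 kq D0 Dn) (erefl l).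
  apply: le_trans (sep_dist_ge g2 H).
  by rewrite lee_fin !exprMn !sqr_sqrtr ?ler0n// mulrAC.
have q0 : 0 < Num.sqrt (n%:R : R) by rewrite sqrtr_gt0 ltr0n.
have kr : 0 < k0%:R :> R by exact: lt_trans qk.
have k00 : (0 < k0)%N by rewrite ltr0n in kr.
set S := ln (1 + k0%:R / Num.sqrt n%:R).
have S2 : ln 2 <= S.
  by rewrite ler_ln ?posrE ?addr_gt0 ?divr_gt0// -[2]/(1 + 1) lerD2l ler_pdivlMr// mul1r ltW.
have S0 : 0 < S by exact: lt_le_trans S2.
have s2 : 0 <= s ^+ 2 by exact: sqr_ge0.
split=> [Dk|kD].
  have [rho H h] := hard_rate_min s0 qk D0 Dk.
  apply: le_trans (sep_dist_ge g2 H); rewrite lee_fin; apply: le_trans h.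
  rewrite -/S -/c0.
  have L0 : 0 <= ln (1 + k0%:R / D%:R) :> R.
    by rewrite ln_ge0// lerDl divr_ge0// ler0n.
  apply: ler_wpM2r.
    by rewrite mulr_ge0 ?ler0n// le_min L0 divr_ge0 ?sqr_ge0// ltW.
  apply: ler_wpM2r => //; rewrite -[leRHS]mulr1; apply: ler_wpM2l; first exact: ltW.
  by rewrite exprn_ile1// ltW.
have kn : (k0 <= minn k0 (n - k0))%N by rewrite leq_min leqnn (leq_trans (ltnW kD)).
have [rho H h] := hard_rate_min s0 qk k00 kn.
have {}H := hard_leD (ltnW kD) H.
apply: le_trans (sep_dist_ge g2 H); rewrite lee_fin; apply: le_trans h.
rewrite -/S -/c0 divff ?gt_eqF//.
have -> : 1 + 1 = 2 :> R by [].
(* k0 > sqrt n gives S >= ln 2, so the quotient is the smaller term. *)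
have -> : Num.min (ln 2 ^+ 2 / S) (ln 2) = ln 2 ^+ 2 / S.
  by apply/min_idPl; rewrite ler_pdivrMr// expr2 ler_wpM2l// ltW.
by rewrite le_eqVlt; apply/orP; left; apply/eqP; ring.
Qed.
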